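(* Let $X$, $Y$ be real random variables with respective characteristic functions $\phi$ and $\psi$. Assume: (i) there exist $p\in\mathbb{N}=\{0,1,2,\dots\}$, $C'>0$ and $0<\epsilon<1$ such that $|\psi(\xi)-\phi(\xi)|\le C'\epsilon|\xi|^p$ for all $\xi\in\mathbb{R}$; (ii) there exist $\lambda>0$, $C>0$, $\alpha>0$ such that for all $A>0$, $\mathbb{P}[|X|>A]\le Ce^{-\lambda A^\alpha}$ and $\mathbb{P}[|Y|>A]\le Ce^{-\lambda A^\alpha}$. Then $$\mathcal{W}_{p+1}(X,Y)\le 2\epsilon\left[C+\frac{2^{p-1}\sqrt{10}\,C'C_p}{\pi}\sqrt{1+\left(\lambda^{-1}\ln(1/\epsilon)\right)^{1/\alpha}}\right],$$ where $C_p$ is a constant depending only on $p$. One can take $C_0=3$, $C_1=12$, $C_2=100$.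
   Context: For an integer $k\ge1$, the smooth Wasserstein distance is $\mathcal{W}_k(X,Y)=\sup_{h\in\mathcal{H}_k}|\mathbb{E}[h(X)]-\mathbb{E}[h(Y)]|$, where $\mathcal{H}_k=\{h\in\mathcal{C}^k(\mathbb{R}) : \|h^{(j)}\|_\infty\le1,\ \forall\,0\le j\le k\}$. *)

(* Defs.v *)
From HB Require Import structures.
From mathcomp Require Import all_boot all_order all_algebra.
From mathcomp Require Import complex.
From mathcomp Require Import all_classical all_reals all_analysis.

Set Implicit Arguments.
Unset Strict Implicit.
Unset Printing Implicit Defensive.

Import Order.TTheory GRing.Theory Num.Theory.
Import numFieldNormedType.Exports.

Local Open Scope classical_set_scope.
Local Open Scope ring_scope.

(* E[exp(i xi X)], with the complex expectation taken componentwise.  Both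
   integrands are bounded and measurable, so [fine] loses nothing. *)
Definition char_fun (d : measure_display) (T : measurableType d)
    (R : realType) (P : probability T R) (X : {RV P >-> R}) (xi : R) : R[i] :=
  Complex (fine ('E_P[fun w => cos (xi * X w)])%E)
          (fine ('E_P[fun w => sin (xi * X w)])%E).

Definition Ck (R : realType) (k : nat) (h : R -> R) : Prop :=
  (forall j, (j < k)%N -> forall x, derivable (derive1n j h) x 1) /\
  continuous (derive1n k h).

Definition sup_norm (R : realType) (f : R -> R) : \bar R :=
  ereal_sup [set `|f x|%:E | x in [set: R]].

Definition test_functions (R : realType) (k : nat) : set (R -> R) :=
  [set h | Ck k h /\
           forall j, (j <= k)%N -> (sup_norm (derive1n j h) <= 1)%E].

(* The distance depends only on the two laws, so X and Y need not be defined
   on the same probability space. *)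
Definition smooth_wasserstein (R : realType) (k : nat)
    (d1 : measure_display) (T1 : measurableType d1) (P : probability T1 R)
    (X : {RV P >-> R})
    (d2 : measure_display) (T2 : measurableType d2) (Q : probability T2 R)
    (Y : {RV Q >-> R}) : \bar R :=
  ereal_sup [set (`|'E_P[h \o X] - 'E_Q[h \o Y]|)%E
            | h in test_functions k].

(* Main.v *)
Require Import Defs.
From mathcomp Require Import all_boot all_order all_algebra.
From mathcomp Require Import complex.
From mathcomp Require Import all_classical all_reals all_analysis.
From mathcomp Require Import measurable_realfun.
From mathcomp Require Import ring lra.

Import Order.TTheory GRing.Theory Num.Theory.
Import numFieldNormedType.Exports.

(** The supremum is bounded one test function h at a time.

    Truncation.  Let A = (ln(1/eps) / lambda)^(1/alpha), the radius beyond which each variable has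
    mass at most C eps, and let g = h chi, where chi equals 1 on [-A, A] and vanishes outside
    [-A-1, A+1].  Replacing h by g costs C eps for X and C eps for Y ([ev_dist]).

    Spectral estimate.  For L > A + 1 let S_N be the partial sums of the Fourier series of g on
    [-L, L], with frequencies x_n = n pi / L and amplitudes r_n.  Since S_N is a finite combination
    of characters, its expectations under the two laws differ by at most
    (1/L) sum r_n |psi(x_n) - phi(x_n)| <= C' eps (1/L) sum r_n x_n^p ([ev_fourier_sum_dist]).
    As g vanishes near the endpoints, r_n x_n^j is the amplitude of the derivative g^(j), so
    Bessel's inequality controls sum r_n^2 x_n^(2p) (1 + theta^2 x_n^2) by the integrals of the
    squares of g^(p) and g^(p+1), while sum 1/(1 + theta^2 x_n^2) <= L / (2 theta) by comparison
    with the arctangent.  By Cauchy-Schwarz, the factors of L cancel, and choosing theta so as to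
    balance the two integrals leaves sqrt(2 (A+1) G_p G_(p+1)), where G_j bounds |g^(j)|
    ([sum_amplitude_freq], [truncated_spectrum]).  Fourier series with this cancellation do the work
    of Plancherel's formula for the Fourier transform of g.

    Inversion.  S_N tends to g uniformly on ]-L, L[, and the S_N are bounded on the whole line
    independently of N and L.  Taking L beyond the radius of mass C delta, and then N large, makes
    E[g - S_N] of order delta for both variables, with delta arbitrary ([ev_test_dist]).  Pointwise
    convergence is the argument of Chernoff: up to a factor, S_N(x) - g(x) is the coefficient of a
    continuous function against the N-th member of an orthogonal family ([fourier_sum_error]), hence
    small for infinitely many N by Bessel's inequality; the tail of sum r_n then gives uniformity.

    Constants.  The edges of chi are the polynomial 1 - (1 - x^m)^m with m = p + 2, which is flat
    enough at 0 and 1 for chi to be of class C^(p+1), and the Leibniz rule turns bounds on its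
    derivatives into G_j.  Since pi <= 4, a constant C_p is admissible as soon as
    32 G_p G_(p+1) <= 10 4^p C_p^2; explicit estimates of the derivatives show that 3, 12 and 100
    satisfy this for p = 0, 1, 2 ([jet_bound_const]). *)

Local Open Scope complex_scope.
Local Open Scope classical_set_scope.
Local Open Scope ring_scope.

(** * Integration over a segment *)

Section segment_integral.
Context {R : realType} (a b : R).
Implicit Types f g F G : R -> R.

Definition segint f : R := \int[lebesgue_measure]_(t in `[a, b]) f t.

Definition segcont f := {within `[a, b], continuous (f : R^o -> R^o)}.

Lemma continuous_segcont {f} : continuous f -> segcont f.
Proof. by move=> cf; apply: continuous_subspaceT. Qed.

Lemma segcont_integrable {f} : segcont f ->
  lebesgue_measure.-integrable `[a, b] (EFin \o f).
Proof. by move=> cf; apply: continuous_compact_integrable => //; exact: segment_compact. Qed.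

Lemma segcontD {f g} : segcont f -> segcont g -> segcont (fun t => f t + g t).
Proof.
move=> /subspace_continuousP cf /subspace_continuousP cg.
by apply/subspace_continuousP => x xab; apply: cvgD; [exact: cf|exact: cg].
Qed.

Lemma segcontM {f g} : segcont f -> segcont g -> segcont (fun t => f t * g t).
Proof.
move=> /subspace_continuousP cf /subspace_continuousP cg.
by apply/subspace_continuousP => x xab; apply: cvgM; [exact: cf|exact: cg].
Qed.

Lemma segcontZ c {f} : segcont f -> segcont (fun t => c * f t).
Proof. by move=> cf; apply: segcontM cf; apply: continuous_segcont => x; exact: cvg_cst. Qed.

Lemma segcont_sum {I : Type} (s : seq I) (F : I -> R -> R) :
  (forall i, segcont (F i)) -> segcont (fun t => \sum_(i <- s) F i t).
Proof.
move=> cF; elim: s => [|i s IH].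
  apply: continuous_segcont; rewrite (_ : (fun _ => _) = cst 0); first by move=> x; exact: cvg_cst.
  by apply/funext => t; rewrite big_nil.
rewrite (_ : (fun _ => _) = (fun t => F i t + \sum_(i <- s) F i t)); first exact: segcontD.
by apply/funext => t; rewrite big_cons.
Qed.

Lemma eq_segint {f} g : (forall t, a <= t <= b -> f t = g t) -> segint f = segint g.
Proof. by move=> fg; apply: eq_Rintegral => t; rewrite inE/= in_itv/=; exact: fg. Qed.

Lemma segintD {f g} : segcont f -> segcont g ->
  segint (fun t => f t + g t) = segint f + segint g.
Proof. by move=> cf cg; rewrite /segint RintegralD//; exact: segcont_integrable. Qed.

Lemma segintZ c {f} : segcont f -> segint (fun t => c * f t) = c * segint f.
Proof. by move=> cf; rewrite /segint RintegralZl//; exact: segcont_integrable. Qed.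

Lemma segint_sum {I : Type} (s : seq I) (F : I -> R -> R) :
  (forall i, segcont (F i)) ->
  segint (fun t => \sum_(i <- s) F i t) = \sum_(i <- s) segint (F i).
Proof.
move=> cF; elim: s => [|i s IH].
  rewrite big_nil (@eq_segint _ (cst 0)); first by rewrite /segint Rintegral_cst// mul0r.
  by move=> t _; rewrite big_nil.
rewrite big_cons -IH -segintD//; last exact: segcont_sum.
by apply: eq_segint => t _; rewrite big_cons.
Qed.

Lemma segint_ge0 {f} : (forall t, a <= t <= b -> 0 <= f t) -> 0 <= segint f.
Proof. by move=> f0; apply: Rintegral_ge0 => t /=; rewrite in_itv/=; exact: f0. Qed.

Lemma le_segint {f} g : segcont f -> segcont g ->
  (forall t, a <= t <= b -> f t <= g t) -> segint f <= segint g.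
Proof.
move=> cf cg fg; apply: le_Rintegral => //.
- exact: segcont_integrable cf.
- exact: segcont_integrable cg.
Qed.

Lemma segint_cst c : a <= b -> segint (cst c) = c * (b - a).
Proof.
move=> ab; rewrite /segint Rintegral_cst//= lebesgue_measure_itv/= lte_fin.
by move: ab; rewrite le_eqVlt => /predU1P[->|->//]; rewrite ltxx subrr.
Qed.

Lemma is_derive_continuous {f} {f' : R -> R} :
  (forall x : R, is_derive x 1 f (f' x)) -> continuous f.
Proof.
move=> df x; apply/differentiable_continuous/derivable1_diffP.
by case: (df x).
Qed.

Lemma is_derive_LRcontinuous {f} {f' : R -> R} :
  (forall x : R, is_derive x 1 f (f' x)) -> derivable_oo_LRcontinuous f a b.
Proof.
move=> df; split.
- by move=> x _; case: (df x).
- exact/cvg_at_right_filter/(is_derive_continuous df).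
- exact/cvg_at_left_filter/(is_derive_continuous df).
Qed.

Lemma segint_parts {F f G g} : a < b ->
  (forall x : R, is_derive x 1 F (f x)) -> continuous f ->
  (forall x : R, is_derive x 1 G (g x)) -> continuous g ->
  segint (fun t => F t * g t) = F b * G b - F a * G a - segint (fun t => f t * G t).
Proof.
move=> ab dF cf dG cg; apply: Rintegration_by_parts => //.
- exact: continuous_segcont.
- exact: (is_derive_LRcontinuous dF).
- by move=> x _; rewrite derive1E; case: (dF x).
- exact: continuous_segcont.
- exact: (is_derive_LRcontinuous dG).
- by move=> x _; rewrite derive1E; case: (dG x).
Qed.

Lemma segint_derive {G g} : a < b ->
  (forall x : R, is_derive x 1 G (g x)) -> continuous g ->
  segint g = G b - G a.
Proof.
move=> ab dG cg.
rewrite /segint /Rintegral (@continuous_FTC2 _ g G)//.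
- exact: continuous_segcont.
- exact: (is_derive_LRcontinuous dG).
- by move=> x _; rewrite derive1E; case: (dG x).
Qed.

(** Expand the integral of (k f - s)^2 >= 0, where s is the combination of the [e i] whose
    coefficients are the integrals of f e_i. *)
Lemma bessel {I : finType} (e : I -> R -> R) (k : R) {f} : 0 < k ->
  (forall i, segcont (e i)) ->
  (forall i j, segint (fun t => e i t * e j t) = k *+ (i == j)) ->
  segcont f ->
  \sum_i segint (fun t => f t * e i t) ^+ 2 <= k * segint (fun t => f t ^+ 2).
Proof.
move=> k0 ce oe cf.
pose c i := segint (fun t => f t * e i t).
pose s t := \sum_i c i * e i t.
have cs : segcont s by apply: segcont_sum => i; exact: segcontZ.
have cff : segcont (fun t => f t ^+ 2) by exact: segcontM.
have fs : segint (fun t => f t * s t) = \sum_i c i ^+ 2.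
  rewrite (@eq_segint _ (fun t => \sum_i c i * (f t * e i t))); last first.
    by move=> t _; rewrite /s mulr_sumr; apply: eq_bigr => i _; ring.
  rewrite segint_sum; last by move=> i; apply: segcontZ; exact: segcontM.
  by apply: eq_bigr => i _; rewrite segintZ//; exact: segcontM.
have es i : segint (fun t => e i t * s t) = k * c i.
  rewrite (@eq_segint _ (fun t => \sum_j c j * (e i t * e j t))); last first.
    by move=> t _; rewrite /s mulr_sumr; apply: eq_bigr => j _; ring.
  rewrite segint_sum; last by move=> j; apply: segcontZ; exact: segcontM.
  rewrite (bigD1 i)//= segintZ; last exact: segcontM.
  rewrite oe eqxx big1 ?addr0; first by rewrite mulr1n mulrC.
  move=> j ji; rewrite segintZ; last exact: segcontM.
  by rewrite oe eq_sym (negbTE ji) mulr0n mulr0.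
have ss : segint (fun t => s t ^+ 2) = k * \sum_i c i ^+ 2.
  rewrite (@eq_segint _ (fun t => \sum_i c i * (e i t * s t))); last first.
    by move=> t _; rewrite expr2 {1}/s mulr_suml; apply: eq_bigr => i _; ring.
  rewrite segint_sum; last by move=> i; apply: segcontZ; exact: segcontM.
  rewrite mulr_sumr; apply: eq_bigr => i _.
  by rewrite segintZ; [rewrite es; ring|exact: segcontM].
have : 0 <= segint (fun t => (k * f t + (-1) * s t) ^+ 2).
  by apply: segint_ge0 => t _; exact: sqr_ge0.
rewrite (@eq_segint _ (fun t => (k ^+ 2 * f t ^+ 2 + (- 2 * k) * (f t * s t)) + s t ^+ 2)); last first.
  by move=> t _; ring.
have cfs : segcont (fun t => f t * s t) by exact: segcontM.
have css : segcont (fun t => s t ^+ 2) by exact: segcontM.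
rewrite segintD//; last by apply: segcontD; exact: segcontZ.
rewrite segintD ?segintZ//; try exact: segcontZ.
rewrite fs ss -/c; set S := \sum_i _; set J := segint _ => H.
have : 0 <= k * (k * J - S) by apply: le_trans H _; lra.
by rewrite pmulr_rge0// subr_ge0.
Qed.

End segment_integral.

(** * Orthogonality of trigonometric functions *)

Section trig.
Context {R : realType}.
Implicit Types (L nu c t : R).

Lemma is_derive_affine nu c t : is_derive t 1 (fun t => nu * t + c) nu.
Proof.
have -> : (fun t => nu * t + c) = (nu \*: (@idfun R)) + cst c.
  by apply/funext => u; rewrite !fctE.
apply: is_derive_eq.
by rewrite addr0 /GRing.scale/= mulr1.
Qed.

Lemma is_derive_cos_affine nu c t :
  is_derive t 1 (fun t => cos (nu * t + c)) (- (nu * sin (nu * t + c))).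
Proof.
have := @is_derive1_comp R cos (fun t => nu * t + c) t _ _ (is_derive_cos _) (is_derive_affine nu c t).
by rewrite mulNr mulrC.
Qed.

Lemma is_derive_sin_affine nu c t :
  is_derive t 1 (fun t => sin (nu * t + c)) (nu * cos (nu * t + c)).
Proof.
have := @is_derive1_comp R sin (fun t => nu * t + c) t _ _ (is_derive_sin _) (is_derive_affine nu c t).
by rewrite mulrC.
Qed.

Lemma continuous_cos_affine nu c : continuous (fun t => cos (nu * t + c)).
Proof. exact: is_derive_continuous (is_derive_cos_affine nu c). Qed.

Lemma continuous_sin_affine nu c : continuous (fun t => sin (nu * t + c)).
Proof. exact: is_derive_continuous (is_derive_sin_affine nu c). Qed.

Lemma sin_natpi n : sin (n%:R * pi : R) = 0.
Proof.
elim: n => [|n IH]; first by rewrite mul0r sin0.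
by rewrite -natr1 mulrDl mul1r sinDpi IH oppr0.
Qed.

Lemma sin_natBpi m n : sin ((m%:R - n%:R) * pi : R) = 0.
Proof. by rewrite mulrBl sinB !sin_natpi mul0r mulr0 subrr. Qed.

(** The segment holds a whole number of periods: the increment of the antiderivative over it
    is a multiple of sin (nu L). *)
Lemma segint_cos L nu c : 0 < L -> nu != 0 -> sin (nu * L) = 0 ->
  segint (- L) L (fun t => cos (nu * t + c)) = 0.
Proof.
move=> L0 nu0 sL.
have dG t : is_derive t (1:R) (fun t => nu^-1 * sin (nu * t + c)) (cos (nu * t + c)).
  have -> : (fun t => nu^-1 * sin (nu * t + c)) = nu^-1 \*: (fun t => sin (nu * t + c)) by [].
  have h := is_derive_sin_affine nu c t.
  by apply: is_derive_eq; rewrite /GRing.scale/= mulKf.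
rewrite (segint_derive _ _ _ dG); last exact: continuous_cos_affine.
  by rewrite mulrN !sinD cosN sinN sL; ring.
by rewrite gtrN.
Qed.

Lemma cosMcos (x y : R) : cos x * cos y = 2^-1 * cos (x - y) + 2^-1 * cos (x + y).
Proof. by rewrite cosB cosD; field. Qed.

(** Phases are kept arbitrary so that sines (phase -pi/2), translates, and the half-integer
    frequencies of the Dirichlet kernel are all covered by this one relation. *)
Lemma segint_cosM L u v c d : 0 < L -> sin ((u - v) * L) = 0 -> sin ((u + v) * L) = 0 ->
  u + v != 0 ->
  segint (- L) L (fun t => cos (u * t + c) * cos (v * t + d)) =
  if u == v then L * cos (c - d) else 0.
Proof.
move=> L0 suB suD uDv0.
have cc nu e : segcont (- L) L (fun t => cos (nu * t + e)).
  by apply: continuous_segcont; exact: continuous_cos_affine.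
rewrite (@eq_segint _ _ _ _ (fun t => 2^-1 * cos ((u - v) * t + (c - d)) +
   2^-1 * cos ((u + v) * t + (c + d)))); last first.
  move=> t _; rewrite cosMcos; congr (_ * cos _ + _ * cos _); ring.
rewrite segintD; [|exact: segcontZ..].
rewrite !segintZ// (segint_cos _ (u + v))// mulr0 addr0.
have [<-|uv] := eqVneq u v; last by rewrite segint_cos ?mulr0// subr_eq0.
rewrite (@eq_segint _ _ _ _ (cst (cos (c - d)))); last by move=> t _; rewrite subrr mul0r add0r.
rewrite segint_cst; last by rewrite ltW// gtrN.
by field.
Qed.

End trig.

(** * Elementary sums *)

Section finite_sums.
Context {R : realType}.

(** Lagrange's identity: the defect is half of a double sum of squares. *)
Lemma cauchy_schwarz_sum {I : Type} (s : seq I) (a b : I -> R) :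
  (\sum_(i <- s) a i * b i) ^+ 2 <= (\sum_(i <- s) a i ^+ 2) * (\sum_(i <- s) b i ^+ 2).
Proof.
have : 0 <= \sum_(i <- s) \sum_(j <- s) (a i * b j - a j * b i) ^+ 2.
  by apply: sumr_ge0 => i _; apply: sumr_ge0 => j _; exact: sqr_ge0.
have -> : \sum_(i <- s) \sum_(j <- s) (a i * b j - a j * b i) ^+ 2 =
    \sum_(i <- s) \sum_(j <- s) (a i ^+ 2 * b j ^+ 2) +
    \sum_(i <- s) \sum_(j <- s) (b i ^+ 2 * a j ^+ 2)
    + (- 2) * (\sum_(i <- s) \sum_(j <- s) (a i * b i) * (a j * b j)).
  rewrite mulr_sumr -!big_split/=; apply: eq_bigr => i _.
  rewrite mulr_sumr -!big_split/=; apply: eq_bigr => j _; ring.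
rewrite -!big_distrlr/=; set A := \sum_(i <- s) a i ^+ 2.
by set B := \sum_(i <- s) b i ^+ 2; set S := \sum_(i <- s) _; nra.
Qed.

Lemma ler_atanB (x y : R) : 0 <= x -> x <= y ->
  (y - x) / (1 + y ^+ 2) <= atan y - atan x.
Proof.
move=> x0 xy.
have [|c cxy ->] := @MVT_segment R atan (fun z => (1 + z ^+ 2)^-1) x y xy (fun z _ => is_derive1_atan z).
  by apply: continuous_subspaceT => z; exact: continuous_atan.
rewrite mulrC ler_wpM2r ?subr_ge0//.
move: cxy; rewrite in_itv/= => /andP[xc cy].
have c0 := le_trans x0 xc.
rewrite lef_pV2 ?posrE ?ltr_pwDl ?sqr_ge0//.
by rewrite lerD2l ler_pXn2r// nnegrE (le_trans c0).
Qed.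

(** Each term is at most the increment of atan over [i h, (i+1) h] divided by h, and
    these increments telescope to less than pi/2. *)
Lemma sum_inv_1Dsqr (h : R) N : 0 < h ->
  \sum_(i < N) (1 + (i.+1%:R * h) ^+ 2)^-1 <= pi / (2 * h).
Proof.
move=> h0.
suff : \sum_(i < N) (1 + (i.+1%:R * h) ^+ 2)^-1 <= atan (N%:R * h) / h.
  move/le_trans; apply; rewrite ler_pdivrMr// [leRHS](_ : _ = pi / 2); last by field; lra.
  by rewrite ltW// atan_ltpi2.
elim: N => [|N IH]; first by rewrite big_ord0 mul0r atan0 mul0r.
rewrite big_ord_recr/= (le_trans (lerD IH (lexx _)))//.
rewrite -lerBrDl -mulrBl ler_pdivlMr// mulrC.
have := @ler_atanB (N%:R * h) (N.+1%:R * h).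
rewrite (_ : N.+1%:R * h - N%:R * h = h); last by rewrite -natr1; ring.
apply; first by rewrite mulr_ge0// ltW.
by rewrite ler_wpM2r ?ler_nat// ltW.
Qed.

(** Since 1/(i+1)^2 <= 1/i - 1/(i+1), the sum telescopes. *)
Lemma sum_inv_sqr N M : (0 < N)%N ->
  \sum_(N <= i < M) (i.+1%:R ^+ 2 : R)^-1 <= N%:R^-1.
Proof.
move=> N0; suff H : (N <= M)%N -> \sum_(N <= i < M) (i.+1%:R ^+ 2 : R)^-1 <= N%:R^-1 - M%:R^-1.
  have [NM|/ltnW MN] := leqP N M; last by rewrite big_geq// invr_ge0.
  by rewrite (le_trans (H NM))// gerBl invr_ge0.
elim: M => [|M IH NM]; first by rewrite leqn0 => /eqP ->; rewrite big_geq// subrr.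
have [->|NM'] := eqVneq N M.+1; first by rewrite big_geq// subrr.
have {}NM' : (N <= M)%N by rewrite -ltnS ltn_neqAle NM' NM.
rewrite big_nat_recr//= (le_trans (lerD (IH NM') (lexx _)))//.
have M0 : 0 < M%:R :> R by rewrite ltr0n (leq_trans N0).
rewrite -addrA lerD2l -natr1; set m : R := M%:R in M0 *.
have m1 : 0 < m + 1 by lra.
rewrite -subr_ge0 [leRHS](_ : _ = (m * (m + 1) ^+ 2)^-1); last by field; rewrite !lt0r_neq0.
by rewrite invr_ge0 mulr_ge0 ?sqr_ge0// ltW.
Qed.

End finite_sums.

(** * Fourier coefficients on a symmetric segment *)

Section fourier.
Context {R : realType} (L : R).
Context (L0 : 0 < L).
Implicit Types (f F : R -> R) (G : nat -> R -> R) (n N : nat).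

Definition freq n : R := n%:R * (pi / L).
Definition cos_coef f n := segint (- L) L (fun t => f t * cos (freq n * t)).
Definition sin_coef f n := segint (- L) L (fun t => f t * sin (freq n * t)).
(** The unnormalized modulus of the Fourier coefficient at frequency n.  Derivation exchanges
    the cosine and sine coefficients, up to sign, and multiplies both by the frequency, so
    that this modulus is simply multiplied by the frequency. *)
Definition amplitude f n := Num.sqrt (cos_coef f n ^+ 2 + sin_coef f n ^+ 2).

Let NLL : - L < L. Proof. by rewrite gtrN. Qed.

Lemma freq_ge0 n : 0 <= freq n.
Proof. by rewrite mulr_ge0// divr_ge0 ?pi_ge0// ltW. Qed.

Lemma freqS_gt0 n : 0 < freq n.+1.
Proof. by rewrite mulr_gt0// divr_gt0// pi_gt0. Qed.

Lemma freqML n : freq n * L = n%:R * pi.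
Proof. by rewrite /freq; field; rewrite lt0r_neq0. Qed.

Lemma continuous_cosfreq n : continuous (fun t => cos (freq n * t)).
Proof.
rewrite (_ : (fun _ => _) = (fun t => cos (freq n * t + 0))); first exact: continuous_cos_affine.
by apply/funext => t; rewrite addr0.
Qed.

Lemma continuous_sinfreq n : continuous (fun t => sin (freq n * t)).
Proof.
rewrite (_ : (fun _ => _) = (fun t => sin (freq n * t + 0))); first exact: continuous_sin_affine.
by apply/funext => t; rewrite addr0.
Qed.

Lemma amplitude_sqr f n : amplitude f n ^+ 2 = cos_coef f n ^+ 2 + sin_coef f n ^+ 2.
Proof. by rewrite sqr_sqrtr// addr_ge0 ?sqr_ge0. Qed.

(** The index type pairs a positive frequency with a boolean choosing cosine or sine, the
    sine being a cosine of phase -pi/2. *)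
Lemma bessel_amplitude {f} N : segcont (- L) L f ->
  \sum_(i < N) amplitude f i.+1 ^+ 2 <= L * segint (- L) L (fun t => f t ^+ 2).
Proof.
move=> cf.
pose e (p : 'I_N * bool) t := cos (freq p.1.+1 * t + (if p.2 then 0 else - (pi / 2))).
have ce p : segcont (- L) L (e p).
  by apply: continuous_segcont; exact: continuous_cos_affine.
have oe p q : segint (- L) L (fun t => e p t * e q t) = L *+ (p == q).
  have suD : (freq p.1.+1 + freq q.1.+1) != 0.
    by rewrite lt0r_neq0// addr_gt0// freqS_gt0.
  rewrite segint_cosM//; first last.
  - by rewrite mulrDl !freqML -mulrDl -natrD sin_natpi.
  - by rewrite mulrBl !freqML -mulrBl sin_natBpi.
  have [pq|pq] := eqVneq p.1 q.1; last first.
    have -> : (p == q) = false by apply: contraNF pq => /eqP ->.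
    rewrite ifN// (inj_eq (mulIf _)) ?eqr_nat ?eqSS//.
    by rewrite lt0r_neq0// divr_gt0// pi_gt0.
  rewrite pq eqxx; case: p q pq {ce suD} => [i b] [j c] /= ->.
  by case: b c => [] [] /=; rewrite ?eqxx ?subr0 ?sub0r ?opprK ?addNr ?subrr ?cosN
    ?cos0 ?cos_pihalf ?mulr1 ?mulr0//;
    case: eqP => // -[].
have := bessel (- L) L e L L0 ce oe cf.
rewrite -(pair_bigA _ (fun i b => segint (- L) L (fun t => f t * e (i, b) t) ^+ 2))/=.
congr (_ <= _); apply: eq_bigr => i _.
rewrite big_bool/= amplitude_sqr; congr (_ ^+ 2 + _ ^+ 2);
  apply: eq_segint => t _; congr (_ * _); rewrite /e/=.
  by rewrite addr0.
by rewrite cosBpihalf.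
Qed.

(** Integration by parts has no boundary term because F vanishes at both endpoints. *)
Lemma fourier_parts {F f} n : (forall x : R, is_derive x 1 F (f x)) -> continuous f ->
  F L = 0 -> F (- L) = 0 ->
  cos_coef f n = freq n * sin_coef F n /\ sin_coef f n = - (freq n * cos_coef F n).
Proof.
move=> dF cf FL FNL; have cF := is_derive_continuous dF.
have dcos t : is_derive t (1:R) (fun t => cos (freq n * t)) (- (freq n * sin (freq n * t))).
  by have := is_derive_cos_affine (freq n) 0 t; under eq_fun do rewrite addr0; rewrite addr0.
have dsin t : is_derive t (1:R) (fun t => sin (freq n * t)) (freq n * cos (freq n * t)).
  by have := is_derive_sin_affine (freq n) 0 t; under eq_fun do rewrite addr0; rewrite addr0.
have cFM (h : R -> R) : continuous h -> segcont (- L) L (fun t => F t * h t).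
  by move=> ch; apply: segcontM; exact: continuous_segcont.
split.
  have := segint_parts _ _ NLL dF cf dcos _.
  rewrite FL FNL !mul0r subrr sub0r => /(_ _)/esym/eqP; rewrite eqr_oppLR => E.
  rewrite /cos_coef (eqP (E _)); last first.
    move=> t; apply: cvgN; apply: cvgM; [exact: cvg_cst|exact: continuous_sinfreq].
  rewrite (@eq_segint _ _ _ _ (fun t => - freq n * (F t * sin (freq n * t)))); last first.
    by move=> t _; ring.
  by rewrite segintZ ?mulNr ?opprK//; apply: cFM; exact: continuous_sinfreq.
have := segint_parts _ _ NLL dF cf dsin _.
rewrite FL FNL !mul0r subrr sub0r => /(_ _)/esym/eqP; rewrite eqr_oppLR => E.
rewrite /sin_coef (eqP (E _)); last first.
  move=> t; apply: cvgM; [exact: cvg_cst|exact: continuous_cosfreq].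
rewrite (@eq_segint _ _ _ _ (fun t => freq n * (F t * cos (freq n * t)))); last by move=> t _; ring.
by rewrite segintZ//; apply: cFM; exact: continuous_cosfreq.
Qed.

Lemma amplitude_derive {F f} n : (forall x : R, is_derive x 1 F (f x)) -> continuous f ->
  F L = 0 -> F (- L) = 0 -> amplitude f n = freq n * amplitude F n.
Proof.
move=> dF cf FL FNL; have [cE sE] := fourier_parts n dF cf FL FNL.
rewrite /amplitude cE sE sqrrN !(exprMn _ (freq n)) -mulrDr addrC sqrtrM ?sqr_ge0//.
by rewrite sqrtr_sqr ger0_norm ?freq_ge0.
Qed.

Lemma amplitude_derivn {G k} n :
  (forall j, (j < k)%N -> forall x : R, is_derive x 1 (G j) (G j.+1 x)) ->
  (forall j, (j <= k)%N -> continuous (G j)) ->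
  (forall j, (j < k)%N -> G j L = 0 /\ G j (- L) = 0) ->
  amplitude (G k) n = freq n ^+ k * amplitude (G 0%N) n.
Proof.
elim: k => [|k IH] dG cG G0; first by rewrite expr0 mul1r.
have [GL GNL] := G0 k (ltnSn k).
rewrite (amplitude_derive n (dG k (ltnSn k)) (cG _ (leqnn _)) GL GNL).
have -> : amplitude (G k) n = freq n ^+ k * amplitude (G 0%N) n.
  by apply: IH => j jk; [apply: dG|apply: cG|apply: G0]; exact: leqW.
by rewrite exprS mulrA.
Qed.

(** The discrete substitute for bounding the integral of |G^| x^p by Plancherel's formula.
    Weighting Cauchy-Schwarz by 1 + th^2 x^2 with th = u / v makes the contributions of
    the two derivatives equal; the result is then L times a quantity free of L. *)
Lemma sum_amplitude_freq {G p} N (K u v : R) :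
  (forall j, (j < p.+1)%N -> forall x : R, is_derive x 1 (G j) (G j.+1 x)) ->
  (forall j, (j <= p.+1)%N -> continuous (G j)) ->
  (forall j, (j < p.+1)%N -> G j L = 0 /\ G j (- L) = 0) ->
  0 <= K -> 0 < u -> 0 < v ->
  segint (- L) L (fun t => G p t ^+ 2) <= K * u ^+ 2 ->
  segint (- L) L (fun t => G p.+1 t ^+ 2) <= K * v ^+ 2 ->
  \sum_(i < N) amplitude (G 0%N) i.+1 * freq i.+1 ^+ p <= L * Num.sqrt (K * u * v).
Proof.
move=> dG cG G0 K0 u0 v0 Gu Gv.
pose th := u / v; have th0 : 0 < th by exact: divr_gt0.
have Ap n : amplitude (G p) n = freq n ^+ p * amplitude (G 0%N) n.
  by apply: amplitude_derivn => j jp; [apply: dG|apply: cG|apply: G0]; exact: leqW.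
have Ap1 n : amplitude (G p.+1) n = freq n ^+ p.+1 * amplitude (G 0%N) n.
  exact: amplitude_derivn.
pose w (i : 'I_N) : R := 1 + (i.+1%:R * (th * (pi / L))) ^+ 2.
have w0 i : 0 < w i by rewrite ltr_pwDl ?sqr_ge0.
have wE i : w i = 1 + th ^+ 2 * freq i.+1 ^+ 2 by rewrite /w /freq; ring.
pose a (i : 'I_N) := amplitude (G 0%N) i.+1 * freq i.+1 ^+ p * Num.sqrt (w i).
have aS i : a i ^+ 2 = amplitude (G p) i.+1 ^+ 2 + th ^+ 2 * amplitude (G p.+1) i.+1 ^+ 2.
  by rewrite /a Ap Ap1 exprMn sqr_sqrtr ?ltW// wE (exprSr _ p); ring.
have Sa : \sum_i a i ^+ 2 <= L * (2 * K * u ^+ 2).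
  under eq_bigr do rewrite aS.
  rewrite big_split/= -mulr_sumr.
  have cont j : (j <= p.+1)%N -> segcont (- L) L (G j).
    by move=> jp; apply: continuous_segcont; exact: cG.
  have B1 := le_trans (bessel_amplitude N (cont p (leqnSn p))) (ler_wpM2l (ltW L0) Gu).
  have B2 := le_trans (bessel_amplitude N (cont p.+1 (leqnn _))) (ler_wpM2l (ltW L0) Gv).
  rewrite (le_trans (lerD B1 (ler_wpM2l (sqr_ge0 th) B2)))//.
  rewrite le_eqVlt; apply/orP; left; apply/eqP; rewrite /th; field.
  by rewrite lt0r_neq0.
have Sb : \sum_i (Num.sqrt (w i)^-1) ^+ 2 <= L * v / (2 * u).
  under eq_bigr => i _ do rewrite sqr_sqrtr ?invr_ge0 ?ltW//.
  have hp : 0 < th * (pi / L) by rewrite mulr_gt0// divr_gt0// pi_gt0.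
  rewrite (le_trans (sum_inv_1Dsqr _ N hp))// le_eqVlt; apply/orP; left; apply/eqP; rewrite /th.
  have := pi_gt0 R; move: (pi : R) => P P0; field.
  by rewrite !lt0r_neq0.
have E : \sum_(i < N) amplitude (G 0%N) i.+1 * freq i.+1 ^+ p = \sum_i a i * Num.sqrt (w i)^-1.
  apply: eq_bigr => i _; rewrite /a -mulrA -sqrtrM ?ltW// divff ?lt0r_neq0//.
  by rewrite sqrtr1 mulr1.
rewrite E -(@ler_pXn2r _ 2)// ?nnegrE; first last.
- by rewrite mulr_ge0 ?sqrtr_ge0// ltW.
- by apply: sumr_ge0 => i _; rewrite !mulr_ge0 ?sqrtr_ge0// exprn_ge0// freq_ge0.
rewrite (le_trans (cauchy_schwarz_sum _ _ _))// exprMn sqr_sqrtr; last by rewrite !mulr_ge0// ltW.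
rewrite (le_trans (ler_pM _ _ Sa Sb))//; [by apply: sumr_ge0 => i _; exact: sqr_ge0..|].
by rewrite le_eqVlt; apply/orP; left; apply/eqP; field; rewrite lt0r_neq0.
Qed.

End fourier.

(** * The Dirichlet kernel *)

Section dirichlet.
Context {R : realType}.

(** Multiplying by sin (y/2) makes the cosine sum telescope. *)
Lemma dirichlet_kernel (y : R) N :
  sin (2^-1 * y) * (2^-1 + \sum_(i < N) cos (i.+1%:R * y)) =
  2^-1 * sin ((N%:R + 2^-1) * y).
Proof.
elim: N => [|N IH]; first by rewrite big_ord0 addr0 mulrC add0r.
rewrite big_ord_recr/= addrA mulrDr IH.
have -> : (N.+1%:R + 2^-1) * y = N.+1%:R * y + 2^-1 * y by ring.
have -> : (N%:R + 2^-1) * y = N.+1%:R * y - 2^-1 * y by rewrite -natr1; field.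
by rewrite sinB sinD; field.
Qed.

(** The difference quotient of f at x, extended by the derivative, is continuous everywhere
    and not only at x, so that it can be integrated. *)
Lemma continuous_caratheodory {f : R -> R} {x a : R} :
  continuous f -> is_derive x 1 f a ->
  exists d : R -> R, [/\ forall z, f z - f x = d z * (z - x), continuous d & d x = a].
Proof.
move=> cf /is_derive1_caratheodory[d [dE dx da]]; exists d; split => // t.
have [->//|tx] := eqVneq t x.
have E z : z != x -> d z = (f z - f x) / (z - x).
  by move=> zx; rewrite dE mulfK// subr_eq0.
have cq : (fun z => (f z - f x) / (z - x)) @ t --> (f t - f x) / (t - x).
  have c1 : (fun z => f z - f x) @ t --> f t - f x by apply: cvgB; [exact: cf|exact: cvg_cst].
  have c2 : (fun z => z - x) @ t --> t - x by apply: cvgB; [exact: cvg_id|exact: cvg_cst].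
  by apply: (cvgM c1); apply: cvgV c2; rewrite subr_eq0.
have nt : \forall z \near t, z != x by apply: open_nbhs_nbhs; split => //; exact: open_neq.
rewrite /continuous_at E//; apply: cvg_trans cq.
apply: near_eq_cvg; near=> z; rewrite [RHS]E//.
near: z; exact: nt.
Unshelve. all: by end_near. Qed.

Context (L : R) (L0 : 0 < L).

Definition fourier_sum (f : R -> R) N x : R :=
  L^-1 * (2^-1 * cos_coef L f 0 + \sum_(i < N)
    (cos_coef L f i.+1 * cos (freq L i.+1 * x) + sin_coef L f i.+1 * sin (freq L i.+1 * x))).

Let kernel N (y : R) : R := 2^-1 + \sum_(i < N) cos (freq L i.+1 * y).

Let segcont_kernel N x : segcont (- L) L (fun t => kernel N (t - x)).
Proof.
apply: segcontD; first by apply: continuous_segcont => t; exact: cvg_cst.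
apply: segcont_sum => i; apply: continuous_segcont => t.
apply: (@continuous_comp _ _ _ (fun t => t - x) (fun u => cos (freq L i.+1 * u))).
  by apply: cvgB; [exact: cvg_id|exact: cvg_cst].
exact: continuous_cosfreq.
Qed.

Lemma fourier_sum_kernel {f} N x : continuous f ->
  fourier_sum f N x = L^-1 * segint (- L) L (fun t => f t * kernel N (t - x)).
Proof.
move=> cf; congr (_ * _).
have cf' := continuous_segcont (- L) L cf.
have cfc n : segcont (- L) L (fun t => f t * cos (freq L n * t)).
  by apply: segcontM => //; apply: continuous_segcont; exact: continuous_cosfreq.
have cfs n : segcont (- L) L (fun t => f t * sin (freq L n * t)).
  by apply: segcontM => //; apply: continuous_segcont; exact: continuous_sinfreq.
rewrite (@eq_segint _ _ _ _ (fun t => 2^-1 * (f t * cos (freq L 0 * t)) + \sum_(i < N)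
    (cos (freq L i.+1 * x) * (f t * cos (freq L i.+1 * t)) +
     sin (freq L i.+1 * x) * (f t * sin (freq L i.+1 * t))))); last first.
  move=> t _; rewrite /kernel mulrDr /freq !mul0r cos0 mulr1 mulrC; congr (_ + _).
  rewrite mulr_sumr; apply: eq_bigr => i _; rewrite mulrBr cosB; ring.
rewrite segintD ?segintZ//; first last.
- by apply: segcont_sum => i; apply: segcontD; exact: segcontZ.
- exact: segcontZ.
rewrite segint_sum; last by move=> i; apply: segcontD; exact: segcontZ.
congr (_ + _); apply: eq_bigr => i _.
by rewrite segintD ?segintZ//; [rewrite mulrC [X in _ + X]mulrC|exact: segcontZ..].
Qed.

Lemma segint_kernel N x : segint (- L) L (fun t => kernel N (t - x)) = L.
Proof.
have cc i : segcont (- L) L (fun t => cos (freq L i.+1 * t + (- (freq L i.+1 * x)))).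
  by apply: continuous_segcont; exact: continuous_cos_affine.
rewrite (@eq_segint _ _ _ _ (fun t => cst 2^-1 t +
    \sum_(i < N) cos (freq L i.+1 * t + (- (freq L i.+1 * x))))); last first.
  by move=> t _; rewrite /kernel; congr (_ + _); apply: eq_bigr => i _; rewrite mulrBr.
rewrite segintD; [|by apply: continuous_segcont => t; exact: cvg_cst|exact: segcont_sum].
rewrite segint_sum// big1 ?addr0 => [|i _].
  by rewrite segint_cst; [field|rewrite ltW// gtrN].
by rewrite segint_cos// ?freqML ?sin_natpi// lt0r_neq0// freqS_gt0.
Qed.

(** Chernoff's device: f(t) - f(x) and sin (pi (t - x) / 2L) both vanish to first order at
    t = x, and the sine has no other zero on the segment, so that their quotient q is
    continuous.  It absorbs the denominator of the Dirichlet kernel, and the error becomes a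
    single coefficient of q with respect to the functions
    sin ((N + 1/2) pi (t - x) / L), written here as phase-shifted cosines. *)
Lemma fourier_sum_error {f} {x f' : R} : continuous f -> is_derive x 1 f f' -> - L < x < L ->
  exists2 q : R -> R, segcont (- L) L q &
  forall N, fourier_sum f N x - f x =
    (2 * L)^-1 * segint (- L) L (fun t => q t * cos ((N%:R + 2^-1) * (pi / L) * t +
        (- ((N%:R + 2^-1) * (pi / L) * x) - pi / 2))).
Proof.
move=> cf df /andP[xL1 xL2].
have [d [dE cd _]] := continuous_caratheodory cf df.
pose k : R := 2^-1 * (pi / L).
have k0 : 0 < k by rewrite mulr_gt0// divr_gt0// pi_gt0.
have [e [eE ce ex]] := continuous_caratheodory (continuous_sin_affine k (- (k * x)))
  (is_derive_sin_affine k (- (k * x)) x).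
have {}eE z : sin (k * z - k * x) = e z * (z - x) by rewrite -eE subrr sin0 subr0.
 rewrite subrr cos0 mulr1 in ex.
have e0 t : - L <= t <= L -> e t != 0.
  move=> /andP[tL1 tL2]; have [->|tx] := eqVneq t x; first by rewrite ex lt0r_neq0.
  apply/eqP => E; move/eqP: tx; apply; have := eE t; rewrite E mul0r => S.
  have kL : k * (2 * L) = pi by rewrite /k; field; rewrite lt0r_neq0.
  apply/eqP; rewrite eq_le !leNgt; apply/andP; split; apply/negP => H.
    have : 0 < sin (k * (t - x)).
      by apply: sin_gt0_pi; rewrite mulr_gt0 ?subr_gt0//= -kL ltr_pM2l//; lra.
    by rewrite mulrBr S ltxx.
  have : 0 < sin (k * (x - t)).
    by apply: sin_gt0_pi; rewrite mulr_gt0 ?subr_gt0//= -kL ltr_pM2l//; lra.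
  by rewrite -opprB mulrN sinN mulrBr S oppr0 ltxx.
have cq : segcont (- L) L (fun t => d t / e t).
  apply/subspace_continuousP => t; rewrite /= in_itv/= => tL.
  by apply: cvg_within_filter; apply: cvgM; [exact: cd|apply: cvgV; [exact: e0|exact: ce]].
exists (fun t => d t / e t) => // N; rewrite fourier_sum_kernel//.
set Q := (X in _ = _ * segint _ _ X).
have cK := segcont_kernel N x.
have cfK : segcont (- L) L (fun t => f t * kernel N (t - x)).
  by apply: segcontM => //; exact: continuous_segcont.
have QE t : - L <= t <= L -> f t * kernel N (t - x) + (- f x) * kernel N (t - x) = 2^-1 * Q t.
  move=> tL; rewrite -mulrDl dE /Q addrA cosBpihalf.
  have -> : (N%:R + 2^-1) * (pi / L) * t - (N%:R + 2^-1) * (pi / L) * x =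
    (N%:R + 2^-1) * (pi / L * (t - x)) by ring.
  rewrite mulrCA -dirichlet_kernel.
  have -> : d t * (t - x) = d t / e t * sin (2^-1 * (pi / L * (t - x))).
    rewrite (_ : 2^-1 * _ = k * t - k * x) ?eE; last by rewrite /k; ring.
    by rewrite mulrA divfK// e0.
  rewrite -mulrA; congr (_ * (_ * (_ + _))).
  by apply: eq_bigr => i _; rewrite /freq -[in LHS]mulrA.
have QI : 2^-1 * segint (- L) L Q = segint (- L) L (fun t => f t * kernel N (t - x)) - f x * L.
  rewrite -[X in _ = _ - _ * X](segint_kernel N x) -mulNr.
  rewrite -(segintZ _ _ (- f x))// -segintD//; last exact: segcontZ.
  rewrite -segintZ; first by apply: eq_segint => t tL; rewrite QE.
  by rewrite /Q; apply: (segcontM _ _ cq); apply: continuous_segcont; exact: continuous_cos_affine.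
by rewrite invfM mulrAC QI; field; rewrite lt0r_neq0.
Qed.

End dirichlet.

(** * Convergence of Fourier sums *)

Section fourier_convergence.
Context {R : realType} (L : R) (L0 : 0 < L).
Implicit Types (f : R -> R) (x : R) (N M : nat).

(** The errors are, up to a constant, the coefficients of one function q against an orthogonal
    family, so they are square summable and cannot all exceed d from some rank on.
    Small errors for arbitrarily large M are enough, as convergence of the whole sequence
    comes from the summability of the amplitudes. *)
Lemma fourier_sum_cvg_at {f x} {f' : R} : continuous f -> is_derive x 1 f f' -> - L < x < L ->
  forall (d : R) N, 0 < d -> exists2 M, (N <= M)%N & `|fourier_sum L f M x - f x| <= d.
Proof.
move=> cf df xL d N d0; have [q cq qE] := fourier_sum_error L L0 cf df xL.
apply: contrapT => H.
have {}H M : (N <= M)%N -> d < `|fourier_sum L f M x - f x|.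
  by move=> NM; rewrite ltNge; apply/negP => H'; apply: H; exists M.
pose m i : R := (i%:R + 2^-1) * (pi / L).
have m0 i : 0 < m i by rewrite mulr_gt0// ?divr_gt0 ?pi_gt0// ltr_wpDl.
pose e n (i : 'I_n) t := cos (m i * t + (- (m i * x) - pi / 2)).
have ce n i : segcont (- L) L (e n i) by apply: continuous_segcont; exact: continuous_cos_affine.
have oe n i j : segint (- L) L (fun t => e n i t * e n j t) = L *+ (i == j).
  have Lm (z : R) : z * (pi / L) * L = z * pi by rewrite -mulrA divfK// lt0r_neq0.
  rewrite segint_cosM//; first last.
  - by rewrite lt0r_neq0// addr_gt0.
  - have -> : (m i + m j) * L = (i + j).+1%:R * pi.
      by rewrite -mulrDl Lm -addn1 !natrD; field.
    exact: sin_natpi.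
  - have -> : (m i - m j) * L = (i%:R - j%:R) * pi by rewrite -mulrBl Lm; ring.
    exact: sin_natBpi.
  have -> : (m i == m j) = (i == j).
    rewrite (inj_eq (mulIf _)); last by rewrite lt0r_neq0// divr_gt0// pi_gt0.
    by rewrite (inj_eq (addIr _)) eqr_nat.
  by have [->|//] := eqVneq i j; rewrite subrr cos0 mulr1.
pose V := L * segint (- L) L (fun t => q t ^+ 2).
have B n : \sum_(i < n) segint (- L) L (fun t => q t * e n i t) ^+ 2 <= V.
  exact: bessel.
have D0 : 0 < (2 * L * d) ^+ 2 by rewrite exprn_gt0// !mulr_gt0.
(* With k errors larger than d, the sum of squares would exceed the Bessel bound V. *)
pose k := (Num.truncn (V / (2 * L * d) ^+ 2)).+1.
have : V < k%:R * (2 * L * d) ^+ 2 by rewrite -ltr_pdivrMr// truncnS_gt.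
apply/negP; rewrite -leNgt; apply: le_trans (B (N + k)%N).
rewrite -(big_mkord xpredT (fun i =>
  segint (- L) L (fun t => q t * cos (m i * t + (- (m i * x) - pi / 2))) ^+ 2)).
rewrite (big_cat_nat (leq0n N) (leq_addr k N))/= -[leLHS]add0r lerD//.
  by apply: sumr_ge0 => i _; exact: sqr_ge0.
have -> : k%:R * (2 * L * d) ^+ 2 = \sum_(N <= i < N + k) (2 * L * d) ^+ 2.
  by rewrite sumr_const_nat addKn mulr_natl.
apply: ler_sum_nat => i /andP[Ni _]; rewrite -[leRHS]real_normK ?num_real//.
rewrite ler_pXn2r ?nnegrE ?normr_ge0//; last by rewrite !mulr_ge0// ltW.
have := ltW (H i Ni); rewrite qE normrM gtr0_norm ?invr_gt0 ?mulr_gt0//.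
by rewrite ler_pdivlMl// mulr_gt0.
Qed.

Lemma normr_cos_sin_le (u v y : R) : `|u * cos y + v * sin y| <= Num.sqrt (u ^+ 2 + v ^+ 2).
Proof.
rewrite -(@ler_pXn2r _ 2)// ?nnegrE ?sqrtr_ge0//.
rewrite sqr_sqrtr ?addr_ge0 ?sqr_ge0// real_normK ?num_real//.
have := cos2Dsin2 y; set c := cos y; set s := sin y => cs.
rewrite -[leRHS]mulr1 -cs -subr_ge0.
rewrite (_ : _ - _ = (u * s - v * c) ^+ 2) ?sqr_ge0//; ring.
Qed.

Lemma fourier_sum_bounded {f} N x : continuous f -> (forall t, `|f t| <= 1) ->
  `|fourier_sum L f N x| <= 1 + L^-1 * \sum_(i < N) amplitude L f i.+1.
Proof.
move=> cf f1; rewrite /fourier_sum mulrDr (le_trans (ler_normD _ _))// lerD//.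
  have cc : continuous (fun t => f t * cos (freq L 0 * t)).
    by move=> t; apply: cvgM; [exact: cf|exact: continuous_cosfreq].
  have NLL : - L <= L by rewrite ltW// gtrN.
  have sc c : segcont (- L) L (cst c) by apply: continuous_segcont => t; exact: cvg_cst.
  have cosb t : `|f t * cos (freq L 0 * t)| <= 1.
    by rewrite /freq !mul0r cos0 mulr1.
  have U : cos_coef L f 0 <= 2 * L.
    rewrite (le_trans (le_segint _ _ (cst 1) (continuous_segcont _ _ cc) (sc 1) _))//.
      by move=> t _; have := cosb t; rewrite ler_norml => /andP[].
    by rewrite segint_cst//; lra.
  have D : - (2 * L) <= cos_coef L f 0.
    rewrite (le_trans _ (le_segint _ _ _ (sc (-1)) (continuous_segcont _ _ cc) _))//.
      by rewrite segint_cst//; lra.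
    by move=> t _; have := cosb t; rewrite ler_norml => /andP[].
  rewrite mulrA normrM gtr0_norm ?mulr_gt0 ?invr_gt0// -invfM mulrC ler_pdivrMr ?mulr_gt0//.
  by rewrite ler_norml mul1r; apply/andP; split; lra.
rewrite normrM gtr0_norm ?invr_gt0// ler_wpM2l ?invr_ge0 ?(ltW L0)//.
by rewrite (le_trans (ler_norm_sum _ _ _))// ler_sum// => i _; exact: normr_cos_sin_le.
Qed.

(** The amplitudes of f are those of f' divided by the frequency, so Cauchy-Schwarz and
    Bessel's inequality for f' bound their tail by a constant times N^(-1/2), uniformly
    in x; the pointwise limit is identified along a subsequence. *)
Lemma fourier_sum_uniform {f} {f' : R -> R} :
  (forall x : R, is_derive x 1 f (f' x)) -> continuous f' ->
  f L = 0 -> f (- L) = 0 ->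
  forall d : R, 0 < d -> exists N, forall x, - L < x < L -> `|f x - fourier_sum L f N x| <= d.
Proof.
move=> df cf' fL fNL d d0; have cf := is_derive_continuous df.
pose V := L * segint (- L) L (fun t => f' t ^+ 2).
have h0 : 0 < pi / L :> R by rewrite divr_gt0// pi_gt0.
have V0 : 0 <= V by rewrite mulr_ge0 ?(ltW L0)// segint_ge0// => t _; exact: sqr_ge0.
have tail N M : (0 < N)%N -> (N <= M)%N ->
    (\sum_(N <= i < M) amplitude L f i.+1) ^+ 2 <= V / (pi / L) ^+ 2 / N%:R.
  move=> N0 NM.
  have E i : amplitude L f i.+1 = amplitude L f' i.+1 * (freq L i.+1)^-1.
    rewrite (amplitude_derive L L0 i.+1 df cf' fL fNL) mulrC mulKf// lt0r_neq0// freqS_gt0//.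
  under eq_bigr do rewrite E.
  rewrite (le_trans (cauchy_schwarz_sum _ _ _))// -mulrA ler_pM//.
  - by apply: sumr_ge0 => i _; exact: sqr_ge0.
  - by apply: sumr_ge0 => i _; exact: sqr_ge0.
  - apply: le_trans (bessel_amplitude L L0 M (continuous_segcont _ _ cf')).
    rewrite -(big_mkord xpredT (fun i => amplitude L f' i.+1 ^+ 2)).
    rewrite (big_cat_nat (leq0n N) NM)/= lerDr.
    by apply: sumr_ge0 => i _; exact: sqr_ge0.
  - under eq_bigr do rewrite /freq invfM exprMn exprVn mulrC.
    rewrite -mulr_sumr exprVn ler_wpM2l ?sum_inv_sqr//.
    by rewrite invr_ge0 sqr_ge0.
(* Large enough for the tail of the amplitudes beyond N to be at most L d. *)
pose N := (Num.truncn (V / (pi / L) ^+ 2 / (L * d) ^+ 2)).+1.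
have N0 : (0 < N%:R :> R) by rewrite ltr0n.
have D0 : 0 < (L * d) ^+ 2 by rewrite exprn_gt0// mulr_gt0.
have NV : V / (pi / L) ^+ 2 / N%:R <= (L * d) ^+ 2.
  by rewrite ler_pdivrMr// [leRHS]mulrC -ler_pdivrMr// ltW// truncnS_gt.
exists N => x xL.
apply/ler_addgt0Pr => e e0.
have [M NM Me] := fourier_sum_cvg_at cf (df x) xL e N e0.
rewrite (le_trans (ler_distD (fourier_sum L f M x) _ _))// addrC lerD//; last by rewrite distrC.
rewrite /fourier_sum -mulrBr normrM gtr0_norm ?invr_gt0// ler_pdivrMl//.
pose F i := cos_coef L f i.+1 * cos (freq L i.+1 * x) + sin_coef L f i.+1 * sin (freq L i.+1 * x).
rewrite -!(big_mkord xpredT F) (big_cat_nat (leq0n N) NM)/=.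
set c := 2^-1 * _; set S := \sum_(0 <= i < N) _; set T := \sum_(N <= i < M) _.
rewrite (_ : _ - _ = T); last by ring.
rewrite (le_trans (ler_norm_sum _ _ _))//.
rewrite (le_trans (ler_sum _ (fun i _ => normr_cos_sin_le _ _ _)))//.
rewrite -(@ler_pXn2r _ 2)// ?nnegrE ?(le_trans (tail N M _ NM) NV)//.
  by apply: sumr_ge0 => i _; exact: sqrtr_ge0.
by rewrite mulr_ge0// ltW.
Qed.

End fourier_convergence.

(** * Leibniz rule and clipped polynomials *)

Section leibniz.
Context {R : realType}.

(** The sum of binom(n, i) a_i b_(n-i), written by the recursion that the product rule
    follows; this form avoids binomial coefficients in all proofs and computes for small n. *)
Fixpoint leibniz n (a b : nat -> R) : R :=
  if n is m.+1 then leibniz m (a \o succn) b + leibniz m a (b \o succn)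
  else a 0%N * b 0%N.

Lemma leibniz_right0 n a b : (forall j, (j <= n)%N -> b j = 0) -> leibniz n a b = 0.
Proof.
elim: n a b => [|n IH] a b b0 /=; first by rewrite b0 ?mulr0.
by rewrite !IH ?addr0// => j jn; apply: b0 => //; exact: leqW.
Qed.

Lemma ler_norm_leibniz n (a b A B : nat -> R) :
  (forall j, (j <= n)%N -> `|a j| <= A j) -> (forall j, (j <= n)%N -> `|b j| <= B j) ->
  `|leibniz n a b| <= leibniz n A B.
Proof.
elim: n a b A B => [|n IH] a b A B aA bB /=; first by rewrite normrM ler_pM ?aA ?bB.
rewrite (le_trans (ler_normD _ _))// lerD//; apply: IH => j jn /=;
  by [apply: aA; rewrite ltnS|apply: bB; rewrite ltnS|apply: aA; exact: leqW|apply: bB; exact: leqW].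
Qed.

Lemma is_derive_leibniz n (F G : nat -> R -> R) (x : R) :
  (forall j, (j <= n)%N -> is_derive x 1 (F j) (F j.+1 x)) ->
  (forall j, (j <= n)%N -> is_derive x 1 (G j) (G j.+1 x)) ->
  is_derive x 1 (fun t => leibniz n (F ^~ t) (G ^~ t)) (leibniz n.+1 (F ^~ x) (G ^~ x)).
Proof.
elim: n F G => [|n IH] F G dF dG.
  have h1 := dF 0%N isT; have h2 := dG 0%N isT.
  rewrite (_ : (fun _ => _) = F 0%N * G 0%N)//.
  by apply: is_derive_eq; rewrite /GRing.scale/= addrC [X in X + _]mulrC.
have h1 : is_derive x 1 (fun t => leibniz n (fun j => F j.+1 t) (G ^~ t))
     (leibniz n.+1 (fun j => F j.+1 x) (G ^~ x)).
  by apply: (IH (fun j => F j.+1)) => j jn; [apply: dF|apply: dG; exact: leqW].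
have h2 : is_derive x 1 (fun t => leibniz n (F ^~ t) (fun j => G j.+1 t))
     (leibniz n.+1 (F ^~ x) (fun j => G j.+1 x)).
  by apply: (IH _ (fun j => G j.+1)) => j jn; [apply: dF; exact: leqW|apply: dG].
exact: (@is_deriveD _ _ _ _ _ _ _ _ _ h1 h2).
Qed.

Lemma continuous_leibniz n (F G : nat -> R -> R) :
  (forall j, (j <= n)%N -> continuous (F j)) ->
  (forall j, (j <= n)%N -> continuous (G j)) ->
  continuous (fun t => leibniz n (F ^~ t) (G ^~ t)).
Proof.
elim: n F G => [|n IH] F G cF cG t.
  by apply: cvgM; [exact: cF|exact: cG].
apply: cvgD.
  by apply: (IH (fun j => F j.+1)) => j jn; [apply: cF|apply: cG; exact: leqW].
by apply: (IH _ (fun j => G j.+1)) => j jn; [apply: cF; exact: leqW|apply: cG].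
Qed.

End leibniz.

Section cutoff.
Context {R : realType}.
Implicit Types (u v x : R) (q : {poly R}).

Definition clip u : R := Num.max 0 (Num.min 1 u).

Lemma clip_ge0 u : 0 <= clip u. Proof. by rewrite le_max lexx. Qed.

Lemma clip_le1 u : clip u <= 1.
Proof. by rewrite ge_max ler01 ge_min lexx. Qed.

Lemma clip_le0 u : u <= 0 -> clip u = 0.
Proof. by move=> u0; apply/max_idPl; rewrite ge_min u0 orbT. Qed.

Lemma clip_ge1 u : 1 <= u -> clip u = 1.
Proof. by move=> u1; rewrite /clip (min_idPl u1); apply/max_idPr. Qed.

Lemma clip_id u : 0 <= u <= 1 -> clip u = u.
Proof. by move=> /andP[u0 u1]; rewrite /clip (min_idPr u1); apply/max_idPr. Qed.

Lemma clip_lipschitz u v : `|clip u - clip v| <= `|u - v|.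
Proof.
wlog uv : u v / v <= u.
  by move=> H; have [/H//|/ltW/H] := leP v u; rewrite distrC [leRHS]distrC.
have [u0|u0] := leP u 0; first by rewrite !clip_le0 ?subrr ?normr0// (le_trans uv).
have [v1|v1] := leP 1 v; first by rewrite !clip_ge1 ?subrr ?normr0// (le_trans v1).
have cu : clip u = Num.min 1 u by apply/max_idPr; rewrite le_min ler01 ltW.
have cv : clip v = Num.max 0 v by rewrite /clip (min_idPr (ltW v1)).
have l1 : clip u <= u by rewrite cu ge_min lexx orbT.
have l2 : v <= clip v by rewrite cv le_max lexx orbT.
have l3 : clip v <= clip u by rewrite cu cv ge_max !le_min ler01 (ltW u0) (ltW v1) uv.
by rewrite !ger0_norm ?subr_ge0//; lra.
Qed.

Lemma continuous_clip : continuous clip.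
Proof.
move=> u; apply/cvgrPdist_le => e e0; near=> v.
rewrite (le_trans (clip_lipschitz _ _))//.
Unshelve. all: by end_near. Qed.

(** Inside ]0, 1[ the clipping is the identity.  Elsewhere the clipping has a corner at worst,
    and its difference quotients are bounded by 1, while q' vanishes at the clipped point. *)
Lemma is_derive_horner_clip q u : (deriv q).[0] = 0 -> (deriv q).[1] = 0 ->
  is_derive u 1 (fun x => q.[clip x]) (deriv q).[clip u].
Proof.
move=> q0 q1.
have [d [dE cd dq]] := continuous_caratheodory (@continuous_horner R q) (is_derive_poly q (clip u)).
pose m x := if x == u then 1 else (clip x - clip u) / (x - u).
apply/is_derive1_caratheodory; exists (fun x => d (clip x) * m x); split.
- move=> x; rewrite dE /m; case: eqP => [->|/eqP xu]; first by rewrite !subrr !mulr0.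
  by rewrite -mulrA divfK// subr_eq0.
- have cdc : d (clip x) @[x --> u] --> d (clip u).
    by apply: continuous_comp; [exact: continuous_clip|exact: cd].
  have [/andP[u0 u1]|u01] := boolP (0 < u < 1).
    apply: cvgM => //; rewrite /m eqxx; apply: cvg_near_cst; near=> x.
    case: eqP => // /eqP xu; rewrite !clip_id.
    - by rewrite divff// subr_eq0.
    - by rewrite !ltW.
    - by apply/andP; split; apply: ltW; near: x; [exact: lt_nbhsr|exact: lt_nbhsl].
  have d0 : d (clip u) = 0.
    rewrite dq; move: u01; rewrite negb_and -!leNgt => /orP[/clip_le0 ->//|/clip_ge1 ->//].
  have nd : `|d (clip x)| @[x --> u] --> (0 : R).
    by apply/norm_cvg0P; rewrite -[X in _ --> X]d0; exact: cdc.
  have E : d (clip u) * m u = 0 by rewrite d0 mul0r.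
  rewrite /prop_for /continuous_at E; apply/norm_cvg0P.
  apply: (@squeeze_cvgr _ _ _ _ (cst 0) (fun x => `|d (clip x)|)).
  + near=> x; rewrite normr_ge0/= normrM ler_piMr// /m.
    case: eqP => [_|/eqP xu]; first by rewrite normr1.
    by rewrite normrM normfV ler_pdivrMr ?normr_gt0 ?subr_eq0// mul1r clip_lipschitz.
  + exact: cvg_cst.
  + exact: nd.
- by rewrite /m eqxx mulr1.
Unshelve. all: by end_near. Qed.

End cutoff.

(** * A plateau function with polynomial edges *)

Section smoothstep.
Context {R : realType}.
Implicit Types (u v x A : R) (q r : {poly R}) (m j p : nat).

Lemma derivn_root_Xn r (a : R) m j : (j < m)%N ->
  (derivn j (('X - a%:P) ^+ m * r)).[a] = 0.
Proof.
elim: j m r => [|j IH] [|m] r // jm.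
  by rewrite /= exprS !hornerE subrr !mul0r.
rewrite derivSn derivM deriv_exp derivXsubC mul1r/=.
rewrite (_ : _ + _ = ('X - a%:P) ^+ m * (r *+ m.+1 + ('X - a%:P) * r^`())) ?IH//.
by rewrite mulrDr mulrnAl mulrnAr exprS; congr (_ + _); ring.
Qed.

(** This polynomial rises from 0 to 1 on [0, 1].  It is divisible by X^m, and
    differs from 1 by a multiple of (X - 1)^m, so that its derivatives of orders 1 to m - 1
    vanish at both ends; staying in [0, 1] is visible on its formula. *)
Definition smoothstep m : {poly R} := 1 - (1 - 'X^m) ^+ m.

Lemma horner_smoothstep m u : (smoothstep m).[u] = 1 - (1 - u ^+ m) ^+ m.
Proof. by rewrite /smoothstep !hornerE. Qed.

Lemma smoothstep0 m : (0 < m)%N -> (smoothstep m).[0] = 0.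
Proof. by case: m => // m _; rewrite horner_smoothstep expr0n/= subr0 expr1n subrr. Qed.

Lemma smoothstep1 m : (0 < m)%N -> (smoothstep m).[1] = 1.
Proof. by case: m => // m _; rewrite horner_smoothstep expr1n subrr expr0n subr0. Qed.

Lemma smoothstep_itv m u : 0 <= u <= 1 -> 0 <= (smoothstep m).[u] <= 1.
Proof.
move=> /andP[u0 u1]; rewrite horner_smoothstep.
have um : 0 <= u ^+ m <= 1 by rewrite exprn_ge0// exprn_ile1.
have : 0 <= (1 - u ^+ m) ^+ m <= 1 by rewrite exprn_ge0 ?exprn_ile1//; lra.
lra.
Qed.

Lemma derivn_smoothstep0 m j : (j < m)%N -> (derivn j (smoothstep m)).[0] = 0.
Proof.
move=> jm; rewrite /smoothstep -{1}(expr1n _ m) subrXX subKr.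
by rewrite -{1}['X]subr0 -polyC0 derivn_root_Xn.
Qed.

Lemma derivn_smoothstep1 m j : (0 < j < m)%N -> (derivn j (smoothstep m)).[1] = 0.
Proof.
case: j => // j jm.
have -> : smoothstep m = 1%:P - ('X - 1%:P) ^+ m * (- \sum_(i < m) 'X^i) ^+ m.
  by rewrite /smoothstep -(opprB 'X^m) subrX1 -mulrN exprMn polyC1.
by rewrite derivnB (_ : derivn j.+1 1%:P = 0) ?derivnC// sub0r hornerN derivn_root_Xn ?oppr0.
Qed.

(** The j-th derivative of the plateau function: the difference of two clipped smoothsteps,
    rising on [-A-1, -A] and on [A, A+1].  The index m = p + 2 makes it of class C^(p+1). *)
Definition plateau p A j x : R :=
  (derivn j (smoothstep p.+2)).[clip (x + A + 1)] - (derivn j (smoothstep p.+2)).[clip (x - A)].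

Lemma continuous_plateau p A j : continuous (plateau p A j).
Proof.
have c q a : continuous (fun x => q.[clip (x + a)]).
  move=> x; apply: (@continuous_comp _ _ _ (fun x => clip (x + a)) (horner q));
    last exact: continuous_horner.
  apply: (@continuous_comp _ _ _ (fun x => x + a) clip); last exact: continuous_clip.
  by apply: cvgD; [exact: cvg_id|exact: cvg_cst].
rewrite (_ : plateau p A j = (fun x => (derivn j (smoothstep p.+2)).[clip (x + (A + 1))] -
   (derivn j (smoothstep p.+2)).[clip (x + - A)])).
  by move=> x; apply: cvgB; exact: c.
by apply/funext => x; rewrite /plateau addrA.
Qed.

Lemma is_derive_plateau p A j x : (j <= p)%N -> is_derive x 1 (plateau p A j) (plateau p A j.+1 x).
Proof.
move=> jp.
have d c : is_derive x 1 (fun t => (derivn j (smoothstep p.+2)).[clip (1 * t + c)])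
    (derivn j.+1 (smoothstep p.+2)).[clip (1 * x + c)].
  have := @is_derive1_comp R (fun u => (derivn j (smoothstep p.+2)).[clip u]) (fun t => 1 * t + c) x _ _
    (is_derive_horner_clip _ _ _ _) (is_derive_affine 1 c x).
  rewrite mulr1 -derivnS; apply.
    by rewrite derivn_smoothstep0.
  by rewrite derivn_smoothstep1.
have h1 := d (A + 1); have h2 := d (- A).
have := @is_deriveB _ _ _ _ _ _ _ _ _ h1 h2.
rewrite !mul1r addrA -/(plateau p A j.+1 x).
rewrite (_ : (fun _ => _) - (fun _ => _) = plateau p A j)//.
by apply/funext => t; rewrite /plateau !fctE !mul1r addrA.
Qed.

Lemma plateau_out p A j x : 0 < A -> A + 1 <= `|x| -> plateau p A j x = 0.
Proof.
move=> A0; rewrite /plateau; have [x0|x0] := ger0P x => Ax.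
  by rewrite (clip_ge1 (x + A + 1)) ?(clip_ge1 (x - A)) ?subrr//; lra.
by rewrite (clip_le0 (x + A + 1)) ?(clip_le0 (x - A)) ?subrr//; lra.
Qed.

Lemma plateau_in p A x : `|x| <= A -> plateau p A 0 x = 1.
Proof.
rewrite ler_norml => /andP[x1 x2]; rewrite /plateau clip_ge1 ?clip_le0; [|lra..].
by rewrite /= smoothstep1// smoothstep0// subr0.
Qed.

Lemma plateau0_itv p A x : 0 < A -> 0 <= plateau p A 0 x <= 1.
Proof.
move=> A0; rewrite /plateau/=; have [x0|/ltW x0] := lerP 0 x.
  rewrite clip_ge1 ?smoothstep1//; last lra.
  by have := @smoothstep_itv p.+2 (clip (x - A)); rewrite clip_ge0 clip_le1 => /(_ isT); lra.
rewrite [X in _ - _.[X]]clip_le0 ?smoothstep0// ?subr0; last lra.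
by apply: smoothstep_itv; rewrite clip_ge0 clip_le1.
Qed.

(** The two edges are disjoint: at each point one of the two terms is evaluated at an endpoint
    of [0, 1], where its derivatives vanish. *)
Lemma plateau_le p A j x (S : R) : 0 < A -> (0 < j <= p.+1)%N ->
  (forall u, 0 <= u <= 1 -> `|(derivn j (smoothstep p.+2)).[u]| <= S) ->
  `|plateau p A j x| <= S.
Proof.
move=> A0 /andP[j0 jp] H; rewrite /plateau; have [x0|/ltW x0] := lerP 0 x.
  rewrite clip_ge1; last lra.
  by rewrite derivn_smoothstep1 ?j0// sub0r normrN H// clip_ge0 clip_le1.
rewrite [X in _ - _.[X]]clip_le0; last lra.
by rewrite derivn_smoothstep0// subr0 H// clip_ge0 clip_le1.
Qed.

End smoothstep.

(** * Derivative bounds and the constants *)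

Section constants.
Context {R : realType}.
Implicit Types (u : R) (p j : nat).

Definition coef_norm (q : {poly R}) : R := \sum_(i < size q) `|q`_i|.

Lemma ler_norm_horner (q : {poly R}) u : 0 <= u <= 1 -> `|q.[u]| <= coef_norm q.
Proof.
move=> /andP[u0 u1]; rewrite horner_coef (le_trans (ler_norm_sum _ _ _))// ler_sum// => i _.
by rewrite normrM ler_piMr// normrX ger0_norm// exprn_ile1.
Qed.

(** For p <= 2 the bounds are numerical and tuned to the constants 3, 12 and 100; beyond, the
    sum of the absolute values of the coefficients is a bound on [0, 1].  Entry 0 is the
    bound 1 on the plateau function itself. *)
Definition smoothstep_bound p : nat -> R :=
  match p with
  | 0%N => nth 1 [:: 1; 9 / 5]
  | 1%N => nth 1 [:: 1; 9 / 4; 18]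
  | 2%N => nth 1 [:: 1; 7 / 2; 70; 192]
  | _ => fun j => if j is 0%N then 1 else coef_norm (derivn j (smoothstep p.+2))
  end.

(** A bound for the j-th derivative of the product of a test function, whose derivatives are
    at most 1, with the plateau function. *)
Definition jet_bound p j : R := leibniz j (fun=> 1) (smoothstep_bound p).

Definition wasserstein_const p : R :=
  match p with
  | 0%N => 3 | 1%N => 12 | 2%N => 100
  | _ => 2 * (1 + jet_bound p p * jet_bound p p.+1)
  end.

Lemma smoothstep_bound0 p : smoothstep_bound p 0 = 1.
Proof. by case: p => [|[|[|p]]]. Qed.

Lemma smoothstep_bound_ge0 p j : 0 <= smoothstep_bound p j.
Proof.
case: p => [|[|[|p]]]; case: j => [|[|[|[|j]]]] //=; rewrite ?nth_nil//; try lra;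
  by apply: sumr_ge0.
Qed.

Lemma deriv_smoothstep m :
  deriv (smoothstep m.+1) = m.+1%:R ^+ 2 * ('X^m * (1 - 'X^(m.+1)) ^+ m) :> {poly R}.
Proof.
rewrite /smoothstep derivB derivC deriv_exp derivB derivC derivXn/=; ring.
Qed.

Lemma deriv2_smoothstep3 :
  deriv (deriv (smoothstep 3)) = 18 * ('X * (1 - 'X^3) * (1 - 4 * 'X^3)) :> {poly R}.
Proof.
rewrite deriv_smoothstep -!polyCMn !(derivM, deriv_exp, derivB, derivC, derivX, derivXn)/=; ring.
Qed.

Lemma deriv2_smoothstep4 :
  deriv (deriv (smoothstep 4)) =
  48 * (('X * (1 - 'X^4)) ^+ 2 * (1 - 5 * 'X^4)) :> {poly R}.
Proof.
rewrite deriv_smoothstep -!polyCMn !(derivM, deriv_exp, derivB, derivC, derivX, derivXn)/=; ring.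
Qed.

Lemma deriv3_smoothstep4 :
  deriv (deriv (deriv (smoothstep 4))) =
  96 * ('X * ((1 - 'X^4) * (1 - 20 * 'X^4 + 35 * 'X^8))) :> {poly R}.
Proof.
rewrite deriv2_smoothstep4 -!polyCMn !(derivM, deriv_exp, derivB, derivC, derivX, derivXn)/=; ring.
Qed.

Lemma norm_derivn_smoothstep2 j u : (0 < j <= 1)%N -> 0 <= u <= 1 ->
  `|(derivn j (smoothstep 2)).[u]| <= smoothstep_bound 0 j.
Proof.
move=> jp /andP[u0 u1]; case: j jp => [|[|]]//= _.
rewrite (_ : _.[u] = 4 * (u * (1 - u ^+ 2))); last first.
  by rewrite /= deriv_smoothstep !hornerE/=; ring.
(* u (1 - u^2) is largest at u = 3^(-1/2), about 29/50. *)
have h1 := mulr_ge0 u0 (sqr_ge0 (u - 29 / 50)); have h2 := sqr_ge0 (u - 29 / 50).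
by rewrite ler_norml; apply/andP; split; nra.
Qed.

Lemma norm_derivn_smoothstep3 j u : (0 < j <= 2)%N -> 0 <= u <= 1 ->
  `|(derivn j (smoothstep 3)).[u]| <= smoothstep_bound 1 j.
Proof.
move=> jp /andP[u0 u1]; have u3 : 0 <= 1 - u ^+ 3 <= 1.
  by rewrite subr_ge0 exprn_ile1// gerBl exprn_ge0.
case: j jp => [|[|[|]]]//= _.
  rewrite (_ : _.[u] = 9 * (u * (1 - u ^+ 3)) ^+ 2); last first.
    by rewrite /= deriv_smoothstep !hornerE/=; ring.
  rewrite ger0_norm; last by rewrite mulr_ge0 ?sqr_ge0.
  (* u (1 - u^3) is largest at u = 4^(-1/3), about 63/100, whose square is about 2/5. *)
  have h1 := sqr_ge0 (u ^+ 2 - 2 / 5); have h2 := sqr_ge0 (u - 63 / 100).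
  have : 0 <= u * (1 - u ^+ 3) <= 1 / 2.
    by apply/andP; split; [rewrite mulr_ge0//; lra|nra].
  by nra.
rewrite (_ : _.[u] = 18 * (u * (1 - u ^+ 3) * (1 - 4 * u ^+ 3))); last first.
  by rewrite /= deriv2_smoothstep3 -!polyCMn !hornerE/=; ring.
rewrite normrM ger0_norm// ler_piMr// -mulrA normrM (ger0_norm u0) mulr_ile1//.
by move: (u ^+ 3) u3 => y /andP[y0 y1]; rewrite ler_norml; apply/andP; split; nra.
Qed.

Lemma norm_derivn_smoothstep4 j u : (0 < j <= 3)%N -> 0 <= u <= 1 ->
  `|(derivn j (smoothstep 4)).[u]| <= smoothstep_bound 2 j.
Proof.
move=> jp /andP[u0 u1]; have y1 : 0 <= u ^+ 4 <= 1 by rewrite exprn_ge0// exprn_ile1.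
have v35 : 0 <= u * (1 - u ^+ 4) <= 3 / 5.
  (* u (1 - u^4) is largest at u = 5^(-1/4), about 2/3. *)
  have h1 := mulr_ge0 u0 (sqr_ge0 (u ^+ 2 - 4 / 9)).
  have h2 := mulr_ge0 u0 (sqr_ge0 (u - 2 / 3)); have h3 := sqr_ge0 (u - 2 / 3).
  by apply/andP; split; [rewrite mulr_ge0//; lra|nra].
case: j jp => [|[|[|[|]]]]//= _.
- rewrite (_ : _.[u] = 16 * (u * (1 - u ^+ 4)) ^+ 3); last first.
    by rewrite /= deriv_smoothstep !hornerE/=; ring.
  case/andP: v35 => v0 v1; rewrite ger0_norm; last by rewrite mulr_ge0 ?exprn_ge0.
  have : (u * (1 - u ^+ 4)) ^+ 3 <= (3 / 5) ^+ 3 by rewrite ler_pXn2r// nnegrE; lra.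
  lra.
- rewrite (_ : _.[u] = 48 * ((u * (1 - u ^+ 4)) ^+ 2 * (1 - 5 * u ^+ 4))); last first.
    by rewrite /= deriv2_smoothstep4 -!polyCMn !hornerE/=; ring.
  case/andP: v35 => v0 v1.
  have w : (u * (1 - u ^+ 4)) ^+ 2 <= (3 / 5) ^+ 2 by rewrite ler_pXn2r// nnegrE; lra.
  have n4 : `|1 - 5 * u ^+ 4| <= 4 by rewrite ler_norml; apply/andP; split; lra.
  rewrite normrM ger0_norm// normrM (ger0_norm (sqr_ge0 _)).
  have := ler_pM (sqr_ge0 _) (normr_ge0 _) w n4; lra.
- rewrite (_ : _.[u] = 96 * (u * ((1 - u ^+ 4) * (1 - 20 * u ^+ 4 + 35 * (u ^+ 4) ^+ 2)))); last first.
    by rewrite /= deriv3_smoothstep4 -!polyCMn !hornerE/=; ring.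
  rewrite normrM ger0_norm// normrM (ger0_norm u0).
  have n2 : `|(1 - u ^+ 4) * (1 - 20 * u ^+ 4 + 35 * (u ^+ 4) ^+ 2)| <= 2.
    (* The quadratic factor is least at y = 2/7; the product is largest near y = 4/5. *)
    move: (u ^+ 4) y1 => y /andP[y0 y1]; rewrite ler_norml; apply/andP; split.
      have h1 := mulr_ge0 (_ : 0 <= 1 - y) (sqr_ge0 (y - 2 / 7)); nra.
    have h1 := mulr_ge0 y0 (sqr_ge0 (y - 4 / 5)); have h2 := sqr_ge0 (y - 4 / 5); nra.
  have := ler_pM u0 (normr_ge0 _) u1 n2; lra.
Qed.

Lemma norm_derivn_smoothstep p j u : (0 < j <= p.+1)%N -> 0 <= u <= 1 ->
  `|(derivn j (smoothstep p.+2)).[u]| <= smoothstep_bound p j.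
Proof.
case: p => [|[|[|p]]].
- exact: norm_derivn_smoothstep2.
- exact: norm_derivn_smoothstep3.
- exact: norm_derivn_smoothstep4.
- by case: j => // j _; exact: ler_norm_horner.
Qed.

Lemma leibniz_ge0 n (a b : nat -> R) : (forall j, 0 <= a j) -> (forall j, 0 <= b j) ->
  0 <= leibniz n a b.
Proof.
elim: n a b => [|n IH] a b a0 b0 /=; first by rewrite mulr_ge0.
by rewrite addr_ge0// IH// => j; [apply: a0|apply: b0].
Qed.

Lemma jet_bound_ge1 p j : 1 <= jet_bound p j.
Proof.
rewrite /jet_bound; elim: j => [|j IH] /=; first by rewrite mul1r smoothstep_bound0.
rewrite (le_trans IH)// lerDl leibniz_ge0// => i; exact: smoothstep_bound_ge0.
Qed.

Lemma wasserstein_const_ge0 p : 0 <= wasserstein_const p.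
Proof.
case: p => [|[|[|p]]]; rewrite /wasserstein_const; try lra.
by rewrite mulr_ge0// addr_ge0// mulr_ge0// (le_trans ler01)// jet_bound_ge1.
Qed.

(** The only inequality that the constants have to satisfy.  For p = 0 it reads
    32 (1 + 9/5) = 89.6 <= 90, so that the slope of the edge must stay below 29/16; for p = 1
    and p = 2 the estimates of the derivatives can be crude. *)
Lemma jet_bound_const p :
  32 * (jet_bound p p * jet_bound p p.+1) <= 10 * 4 ^+ p * wasserstein_const p ^+ 2.
Proof.
case: p => [|[|[|p]]]; try by rewrite /jet_bound/=; lra.
rewrite /wasserstein_const; set t := jet_bound _ _ * jet_bound _ _.
have t0 : 0 <= t by rewrite mulr_ge0// (le_trans ler01)// jet_bound_ge1.
have e4 : 1 <= 4 ^+ p.+3 :> R by rewrite exprn_ege1//; lra.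
rewrite (@le_trans _ _ (10 * 1 * (2 * (1 + t)) ^+ 2))//; first nra.
by rewrite ler_wpM2r ?sqr_ge0//; lra.
Qed.

End constants.

(** * Truncated test functions *)

Section truncation.
Context {R : realType}.
Implicit Types (h : R -> R) (p j N : nat) (x A L : R).

Lemma segint_support {f : R -> R} {a L M : R} : 0 < a -> a < L -> continuous f ->
  (forall t, a <= `|t| -> f t = 0) -> (forall t, f t <= M) ->
  segint (- L) L f <= 2 * a * M.
Proof.
move=> a0 aL cf f0 fM.
have -> : segint (- L) L f = segint (- a) a f.
  have sub : `[- L, L] `&` `[- a, a] = `[- a, a]%classic :> set R.
    by apply/setIidPr => t /=; rewrite !in_itv/= => /andP[ta tb]; apply/andP; split; lra.
  rewrite /segint -[in RHS]sub Rintegral_mkcondr; apply: eq_Rintegral => t _.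
  rewrite patchE; case: ifPn => //; rewrite notin_setE/= in_itv/= => /negP ta.
  by apply: f0; rewrite leNgt ltr_norml; apply: contra ta => /andP[/ltW -> /ltW ->].
rewrite (le_trans (le_segint _ _ (cst M) (continuous_segcont _ _ cf) _ _))//.
  by apply: continuous_segcont => t; exact: cvg_cst.
by rewrite segint_cst; lra.
Qed.

Lemma test_function_le1 {k h} j x : test_functions k h -> (j <= k)%N -> `|derive1n j h x| <= 1.
Proof.
move=> [_ hb] jk; rewrite -lee_fin; apply: le_trans (hb j jk).
by apply: ereal_sup_ubound; exists x.
Qed.

Lemma test_function_derive {k h} j x : test_functions k h -> (j < k)%N ->
  is_derive x 1 (derive1n j h) (derive1n j.+1 h x).
Proof.
move=> [[dh _] _] jk; rewrite derive1nS derive1E.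
by apply: DeriveDef => //; exact: dh.
Qed.

Lemma test_function_continuous {k h} j : test_functions k h -> (j <= k)%N ->
  continuous (derive1n j h).
Proof.
move=> th; rewrite leq_eqVlt => /predU1P[->|jk]; first by case: th => -[].
by apply: (is_derive_continuous (f' := derive1n j.+1 h)) => x; exact: (test_function_derive j x th).
Qed.

(** The j-th derivative of the product of h with the plateau function, by the Leibniz rule. *)
Definition truncated p A h j x : R :=
  leibniz j (fun i => derive1n i h x) (fun i => plateau p A i x).

Context {p : nat} {h : R -> R} {A : R} (th : test_functions p.+1 h) (A0 : 0 < A).
Notation G := (truncated p A h).

Lemma is_derive_truncated j x : (j < p.+1)%N -> is_derive x 1 (G j) (G j.+1 x).
Proof.
rewrite ltnS => jp; apply: (is_derive_leibniz j (fun i => derive1n i h) (plateau p A)) => i ij.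
  by apply: (test_function_derive _ _ th); rewrite ltnS (leq_trans ij).
by apply: is_derive_plateau; rewrite (leq_trans ij).
Qed.

Lemma continuous_truncated j : (j <= p.+1)%N -> continuous (G j).
Proof.
move=> jp; apply: (continuous_leibniz j (fun i => derive1n i h) (plateau p A)) => i ij.
  by apply: (test_function_continuous _ th); rewrite (leq_trans ij).
exact: continuous_plateau.
Qed.

Lemma truncated_out j x : A + 1 <= `|x| -> G j x = 0.
Proof. by move=> Ax; apply: leibniz_right0 => i _; exact: plateau_out. Qed.

Lemma truncated_in x : `|x| <= A -> G 0 x = h x.
Proof. by move=> xA; rewrite /truncated/= plateau_in// mulr1. Qed.

Lemma truncated_le j x : (j <= p.+1)%N -> `|G j x| <= jet_bound p j.
Proof.
move=> jp; apply: ler_norm_leibniz => i ij.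
  by apply: (test_function_le1 _ _ th); rewrite (leq_trans ij).
case: i ij => [|i] ij.
  by have /andP[b0 b1] := plateau0_itv p A x A0; rewrite smoothstep_bound0 ger0_norm.
apply: plateau_le => //; first by rewrite (leq_trans ij).
by move=> u; apply: norm_derivn_smoothstep; rewrite (leq_trans ij).
Qed.

Lemma truncated_le1 x : `|G 0 x| <= 1.
Proof.
by have := truncated_le 0 x isT; rewrite /jet_bound/= mul1r smoothstep_bound0.
Qed.

Lemma truncated_dist x : `|h x - G 0 x| <= 1.
Proof.
have /andP[b0 b1] := plateau0_itv p A x A0.
rewrite /truncated/= -{1}[h x]mulr1 -mulrBr normrM mulr_ile1//.
  exact: (test_function_le1 0 x th).
by rewrite ger0_norm; lra.
Qed.

Context {L : R} (AL : A + 1 < L).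

Let A1_gt0 : 0 < A + 1. Proof. by rewrite addr_gt0. Qed.
Let L0 : 0 < L. Proof. exact: lt_trans AL. Qed.

Lemma truncated_endpoints j : G j L = 0 /\ G j (- L) = 0.
Proof. by split; apply: truncated_out; rewrite ?normrN gtr0_norm// ltW. Qed.

Lemma segint_truncated j : (j <= p.+1)%N ->
  segint (- L) L (fun t => G j t ^+ 2) <= 2 * (A + 1) * jet_bound p j ^+ 2.
Proof.
move=> jp; apply: segint_support => //.
- by move=> t; apply: cvgM; exact: continuous_truncated.
- by move=> t tA; rewrite truncated_out// expr0n.
- move=> t; rewrite -real_normK ?num_real// ler_pXn2r ?nnegrE// ?truncated_le//.
  exact: (le_trans ler01 (jet_bound_ge1 _ _)).
Qed.

Lemma truncated_spectrum q N : (q <= p)%N ->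
  L^-1 * (\sum_(i < N) amplitude L (G 0) i.+1 * freq L i.+1 ^+ q) <=
  Num.sqrt (2 * (A + 1) * (jet_bound p q) * (jet_bound p q.+1)).
Proof.
move=> qp; rewrite ler_pdivrMl//.
have jb j : 0 < jet_bound p j by rewrite (lt_le_trans ltr01)// jet_bound_ge1.
apply: (sum_amplitude_freq L L0) => //.
- by move=> j jq x; apply: is_derive_truncated; rewrite (leq_trans jq).
- by move=> j jq; apply: continuous_truncated; rewrite (leq_trans jq).
- by move=> j _; exact: truncated_endpoints.
- by rewrite mulr_ge0// ltW.
- by apply: segint_truncated; exact: leqW.
- exact: segint_truncated.
Qed.

(** The bound does not involve L: this is the spectral estimate at order 0. *)
Lemma truncated_fourier_sum_le N x : `|fourier_sum L (G 0) N x| <=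
  1 + Num.sqrt (2 * (A + 1) * (jet_bound p 0) * (jet_bound p 1)).
Proof.
rewrite (le_trans (fourier_sum_bounded L L0 N x (continuous_truncated 0 isT) truncated_le1))// lerD2l.
by have := truncated_spectrum 0 N isT; under eq_bigr do rewrite expr0 mulr1.
Qed.

Lemma truncated_fourier_sum_uniform (d : R) : 0 < d ->
  exists N, forall x, - L < x < L -> `|G 0 x - fourier_sum L (G 0) N x| <= d.
Proof.
have [GL GNL] := truncated_endpoints 0.
exact: (fourier_sum_uniform L L0 (fun x => is_derive_truncated 0 x isT) (continuous_truncated 1 isT)).
Qed.

End truncation.

(** * Expectations of bounded functions *)

Section bounded_expectation.
Context {R : realType} {d : measure_display} {T : measurableType d}
  {P : probability T R} (X : {RV P >-> R}).
Implicit Types (f g : R -> R) (c M : R).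

(** The expectation of f(X) as a real number; faithful on [bounded_measurable] functions. *)
Definition ev f : R := fine ('E_P[f \o X])%E.

Definition bounded_measurable f :=
  measurable_fun [set: R] f /\ exists M, forall x, `|f x| <= M.

Lemma bounded_measurable_integrable {f} : bounded_measurable f ->
  P.-integrable [set: T] (EFin \o (f \o X)).
Proof.
move=> [mf [M fM]]; apply: measurable_bounded_integrable => //.
- exact: le_lt_trans (probability_le1 P measurableT) (ltry _).
- exact: measurableT_comp.
- by exists M; split; [exact: num_real|move=> y My t _ /=; rewrite (le_trans (fM _))// ltW].
Qed.

Lemma evE {f} : bounded_measurable f -> ('E_P[f \o X])%E = (ev f)%:E.
Proof.
move=> bf; rewrite /ev fineK// unlock.
exact: (integrable_fin_num measurableT (bounded_measurable_integrable bf)).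
Qed.

Lemma ev_Rintegral f : ev f = \int[P]_(w in [set: T]) f (X w).
Proof. by rewrite /ev unlock. Qed.

Lemma bounded_measurableD {f g} : bounded_measurable f -> bounded_measurable g ->
  bounded_measurable (fun x => f x + g x).
Proof.
move=> [mf [M fM]] [mg [N gN]]; split; first exact: measurable_funD.
by exists (M + N) => x; rewrite (le_trans (ler_normD _ _))// lerD.
Qed.

Lemma bounded_measurableZ c {f} : bounded_measurable f ->
  bounded_measurable (fun x => c * f x).
Proof.
move=> [mf [M fM]]; split; first by apply: measurable_funM => //; exact: measurable_cst.
by exists (`|c| * M) => x; rewrite normrM ler_wpM2l.
Qed.

Lemma bounded_measurable_cst c : bounded_measurable (cst c).
Proof. by split; [exact: measurable_cst|exists `|c|]. Qed.

Lemma bounded_measurable_continuous {f} M : continuous f -> (forall x, `|f x| <= M) ->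
  bounded_measurable f.
Proof. by move=> cf fM; split; [exact: continuous_measurable_fun|exists M]. Qed.

Lemma bounded_measurable_sum N (F : 'I_N -> R -> R) : (forall i, bounded_measurable (F i)) ->
  bounded_measurable (fun x => \sum_(i < N) F i x).
Proof.
move=> bF; elim: (index_enum _) => [|i s IH].
  under eq_fun do rewrite big_nil; exact: bounded_measurable_cst.
under eq_fun do rewrite big_cons; exact: bounded_measurableD.
Qed.

Lemma evD {f g} : bounded_measurable f -> bounded_measurable g ->
  ev (fun x => f x + g x) = ev f + ev g.
Proof.
move=> bf bg; rewrite !ev_Rintegral -RintegralD//; exact: bounded_measurable_integrable.
Qed.

Lemma evZ c {f} : bounded_measurable f -> ev (fun x => c * f x) = c * ev f.
Proof.
move=> bf; rewrite !ev_Rintegral -RintegralZl//; exact: bounded_measurable_integrable.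
Qed.

Lemma ev_cst c : ev (cst c) = c.
Proof. by rewrite /ev (_ : _ \o _ = cst c)// expectation_cst. Qed.

Lemma ev_sum N (F : 'I_N -> R -> R) : (forall i, bounded_measurable (F i)) ->
  ev (fun x => \sum_(i < N) F i x) = \sum_(i < N) ev (F i).
Proof.
move=> bF; have [//] : bounded_measurable (fun x => \sum_(i < N) F i x) /\
   ev (fun x => \sum_(i < N) F i x) = \sum_(i < N) ev (F i).
elim: (index_enum _) => [|i s [bs IH]].
  rewrite big_nil; under eq_fun do rewrite big_nil.
  by split; [exact: bounded_measurable_cst|exact: ev_cst].
rewrite big_cons; under eq_fun do rewrite big_cons.
by split; [exact: bounded_measurableD|rewrite evD// IH].
Qed.

(** Used twice: for the truncation, with dl = 0 and M = 1, and for the approximation of a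
    function by its Fourier sums, which is good inside a large interval and merely bounded
    outside it. *)
Lemma ev_dist {f g} (dl M B pr : R) : bounded_measurable f -> bounded_measurable g ->
  (forall x, `|x| <= B -> `|f x - g x| <= dl) ->
  (forall x, `|f x - g x| <= dl + M) -> 0 <= M ->
  (P [set w | (B < `|X w|)%R] <= pr%:E)%E ->
  `|ev f - ev g| <= dl + M * pr.
Proof.
move=> bf bg fgB fgM M0 Ppr.
have -> : ev f - ev g = ev (fun x => f x + (-1) * g x).
  by rewrite evD ?evZ ?mulN1r//; exact: bounded_measurableZ.
have bfg : bounded_measurable (fun x => f x + (-1) * g x).
  by apply: bounded_measurableD => //; exact: bounded_measurableZ.
pose D : set T := [set w | (B < `|X w|)%R].
have mD : measurable D.
  rewrite (_ : D = (fun w => `|X w|) @^-1` `]B, +oo[).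
    rewrite -[_ @^-1` _]setTI; have : measurable_fun [set: T] (fun w => `|X w|).
      by apply: measurableT_comp.
    by apply => //; exact: measurable_itv.
  by apply/seteqP; split => w /=; rewrite in_itv/= andbT.
rewrite ev_Rintegral (le_trans (le_normr_Rintegral _ _))//.
  exact: (bounded_measurable_integrable bfg).
have iD : P.-integrable [set: T] (EFin \o (fun w => dl + M * \1_D w)).
  have bd : measurable_fun [set: T] (fun w => dl + M * \1_D w : R).
    by apply: measurable_funD => //; apply: measurable_funM => //; exact: measurable_indic.
  apply: measurable_bounded_integrable => //.
  - exact: le_lt_trans (probability_le1 P measurableT) (ltry _).
  - exists (`|dl| + M); split; first exact: num_real.
    move=> y My t _ /=; rewrite (le_trans _ (ltW My))// (le_trans (ler_normD _ _))// lerD2l.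
    by rewrite normrM ger0_norm// ler_piMr// indicE; case: (t \in D); rewrite ?normr1 ?normr0.
apply: (@le_trans _ _ (\int[P]_(w in [set: T]) (dl + M * \1_D w))).
  apply: le_Rintegral => //.
    by have := integrable_norm (bounded_measurable_integrable bfg).
  move=> w _; rewrite mulN1r indicE; have [|/negP] := boolP (w \in D).
    by rewrite mulr1.
  rewrite inE /D/= => /negP; rewrite -leNgt mulr0 addr0; exact: fgB.
have iI : P.-integrable [set: T] (EFin \o (fun w => \1_D w : R)).
  exact: integrable_indic.
have iM : P.-integrable [set: T] (EFin \o (fun w => M * \1_D w)).
  rewrite (_ : _ \o _ = (fun w => M%:E * (\1_D w)%:E)%E); first exact: integrableZl.
  by apply/funext => w /=; rewrite EFinM.
have ic : P.-integrable [set: T] (EFin \o (fun=> dl)).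
  exact: (bounded_measurable_integrable (bounded_measurable_cst dl)).
rewrite RintegralD// RintegralZl// (_ : \int[P]__ dl = dl); last first.
  by have := ev_cst dl; rewrite ev_Rintegral.
rewrite lerD2l ler_wpM2l// /Rintegral integral_indic// setIT -lee_fin fineK ?fin_num_measure//.
Qed.

End bounded_expectation.

(** * Tails, characteristic functions and Fourier sums *)

Section main_estimate.
Context {R : realType}.
Implicit Types (lambda C alpha eta : R).

(** The radius at which the tail bound of the hypothesis equals C eta. *)
Definition tail_radius lambda alpha eta : R := (lambda^-1 * ln (1 / eta)) `^ (1 / alpha).

Lemma tail_radius_gt0 lambda alpha eta : 0 < lambda -> 0 < eta < 1 ->
  0 < tail_radius lambda alpha eta.
Proof.
move=> l0 /andP[e0 e1]; rewrite powR_gt0// mulr_gt0 ?invr_gt0// ln_gt0//.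
by rewrite div1r invf_gt1.
Qed.

Lemma expR_tail_radius lambda alpha eta : 0 < lambda -> 0 < alpha -> 0 < eta < 1 ->
  expR (- lambda * tail_radius lambda alpha eta `^ alpha) = eta.
Proof.
move=> l0 a0 /andP[e0 e1].
have ln0 : 0 < ln (1 / eta) by rewrite ln_gt0// div1r invf_gt1.
rewrite /tail_radius -powRrM divfK ?lt0r_neq0// powRr1; last by rewrite mulr_ge0 ?invr_ge0 ?ltW.
by rewrite mulNr mulVKf ?lt0r_neq0// div1r lnV ?posrE// opprK lnK ?posrE.
Qed.

(** The comparison is made after squaring, with pi <= 4. *)
Lemma const_spectrum p (A : R) : 0 < A ->
  Num.sqrt (2 * (A + 1) * (jet_bound p p) * (jet_bound p p.+1)) <=
  2 ^+ p * Num.sqrt 10 * wasserstein_const p / pi * Num.sqrt (1 + A).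
Proof.
move=> A0; have pi0 := pi_gt0 R.
have pi4 : pi <= 4 :> R by have := pihalf_lt2 R; lra.
have W0 := @wasserstein_const_ge0 R p.
have j0 j : 0 <= jet_bound p j :> R by rewrite (le_trans ler01)// jet_bound_ge1.
have E0 : 0 <= 2 ^+ p * Num.sqrt 10 * wasserstein_const p / pi * Num.sqrt (1 + A).
  by rewrite mulr_ge0 ?sqrtr_ge0// divr_ge0 ?(ltW pi0)// !mulr_ge0 ?sqrtr_ge0 ?exprn_ge0.
rewrite -(@ler_pXn2r _ 2)// ?nnegrE ?sqrtr_ge0//.
rewrite sqr_sqrtr; last by rewrite !mulr_ge0//; lra.
rewrite [leRHS]exprMn sqr_sqrtr; last lra.
rewrite (_ : 2 * (A + 1) * _ * _ = 2 * (jet_bound p p * jet_bound p p.+1) * (1 + A)); last by ring.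
rewrite ler_wpM2r//; first lra.
rewrite !exprMn sqr_sqrtr// exprVn ler_pdivlMr ?exprn_gt0//.
have J := @jet_bound_const R p.
have -> : (2 ^+ p) ^+ 2 = 4 ^+ p :> R by rewrite exprAC; congr (_ ^+ _); lra.
set t := jet_bound _ _ * jet_bound _ _ in J *.
have t0 : 0 <= t by rewrite mulr_ge0.
apply: (@le_trans _ _ (2 * t * 4 ^+ 2)).
  by rewrite ler_wpM2l ?mulr_ge0// ler_pXn2r// nnegrE ltW.
by move: J; rewrite [4 ^+ p * 10]mulrC; lra.
Qed.

Lemma ler_Dmul_small (x y K : R) : 0 <= K ->
  (forall dl : R, 0 < dl < 1 -> x <= y + K * dl) -> x <= y.
Proof.
move=> K0 H; apply/ler_addgt0Pr => e e0.
have K1 : 0 < K + 1 by lra.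
have d0 : 0 < Num.min (1 / 2) (e / (K + 1)) < 1.
  by rewrite lt_min divr_gt0//= divr_gt0//= gt_min; apply/orP; left; lra.
rewrite (le_trans (H _ d0))// lerD2l.
have : Num.min (1 / 2) (e / (K + 1)) <= e / (K + 1) by rewrite ge_min lexx orbT.
case/andP: d0; set dl := Num.min _ _ => d0 _; rewrite ler_pdivlMr// => H'; nra.
Qed.

Lemma norm_mul2_le (a b u v r : R) : 0 <= r -> Num.sqrt (u ^+ 2 + v ^+ 2) <= r ->
  `|a * u + b * v| <= Num.sqrt (a ^+ 2 + b ^+ 2) * r.
Proof.
move=> r0 uvr.
have s0 : 0 <= u ^+ 2 + v ^+ 2 by rewrite addr_ge0 ?sqr_ge0.
have t0 : 0 <= a ^+ 2 + b ^+ 2 by rewrite addr_ge0 ?sqr_ge0.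
apply: le_trans (ler_wpM2l (sqrtr_ge0 _) uvr).
rewrite -sqrtrM// -sqrtr_sqr ler_wsqrtr//.
rewrite -subr_ge0 (_ : _ - _ = (a * v - b * u) ^+ 2) ?sqr_ge0//; ring.
Qed.

Context {d1 d2 : measure_display} {T1 : measurableType d1} {T2 : measurableType d2}
  {P : probability T1 R} {Q : probability T2 R} (X : {RV P >-> R}) (Y : {RV Q >-> R}).

Lemma char_fun_ev {d} {T : measurableType d} {S : probability T R} (Z : {RV S >-> R}) (xi : R) :
  char_fun Z xi = Complex (ev Z (fun x => cos (xi * x))) (ev Z (fun x => sin (xi * x))).
Proof. by []. Qed.

Lemma bounded_measurable_cosM (xi : R) : bounded_measurable (fun x => cos (xi * x)).
Proof.
apply: (bounded_measurable_continuous 1); last by move=> x; rewrite cos_max.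
move=> x; apply: (@continuous_comp _ _ _ (fun x => xi * x) cos); last exact: continuous_cos.
by apply: cvgM; [exact: cvg_cst|exact: cvg_id].
Qed.

Lemma bounded_measurable_sinM (xi : R) : bounded_measurable (fun x => sin (xi * x)).
Proof.
apply: (bounded_measurable_continuous 1); last by move=> x; rewrite sin_max.
move=> x; apply: (@continuous_comp _ _ _ (fun x => xi * x) sin); last exact: continuous_sin.
by apply: cvgM; [exact: cvg_cst|exact: cvg_id].
Qed.

Lemma bounded_measurable_fourier_sum L f N : bounded_measurable (fourier_sum L f N : R -> R).
Proof.
apply: bounded_measurableZ; apply: bounded_measurableD; first exact: bounded_measurable_cst.
apply: bounded_measurable_sum => i; apply: bounded_measurableD; apply: bounded_measurableZ.
- exact: bounded_measurable_cosM.
- exact: bounded_measurable_sinM.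
Qed.

Lemma ev_fourier_sum {d} {T : measurableType d} {S : probability T R} (Z : {RV S >-> R}) L f N :
  ev Z (fourier_sum L f N) = L^-1 * (2^-1 * cos_coef L f 0 + \sum_(i < N)
    (cos_coef L f i.+1 * ev Z (fun x => cos (freq L i.+1 * x)) +
     sin_coef L f i.+1 * ev Z (fun x => sin (freq L i.+1 * x)))).
Proof.
have bc xi := bounded_measurable_cosM xi; have bs xi := bounded_measurable_sinM xi.
have bi (i : 'I_N) : bounded_measurable (fun x => cos_coef L f i.+1 * cos (freq L i.+1 * x)
    + sin_coef L f i.+1 * sin (freq L i.+1 * x)).
  by apply: bounded_measurableD; exact: bounded_measurableZ.
rewrite evZ; last first.
  apply: bounded_measurableD; first exact: bounded_measurable_cst.
  exact: bounded_measurable_sum.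
congr (_ * _); rewrite evD; first last.
- exact: bounded_measurable_sum.
- exact: bounded_measurable_cst.
rewrite ev_cst ev_sum//; congr (_ + _); apply: eq_bigr => i _.
by rewrite evD ?evZ//; exact: bounded_measurableZ.
Qed.

(** The constant terms cancel, and the pair of differences of cosine and sine moments at a
    given frequency is the difference of characteristic functions there. *)
Lemma ev_fourier_sum_dist L f N p (c B : R) : 0 < L -> 0 <= c ->
  (forall xi : R, `|char_fun Y xi - char_fun X xi| <= ((c * `|xi| ^+ p)%:C)%C) ->
  L^-1 * (\sum_(i < N) amplitude L f i.+1 * freq L i.+1 ^+ p) <= B ->
  `|ev X (fourier_sum L f N) - ev Y (fourier_sum L f N)| <= c * B.
Proof.
move=> L0 c0 H HB; rewrite !ev_fourier_sum -mulrBr normrM gtr0_norm ?invr_gt0//.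
apply: le_trans (ler_wpM2l c0 HB); rewrite mulrCA ler_wpM2l ?invr_ge0 ?(ltW L0)//.
rewrite opprD addrACA subrr add0r -sumrB mulr_sumr (le_trans (ler_norm_sum _ _ _))//.
apply: ler_sum => i _; rewrite opprD addrACA -!mulrBr mulrCA.
rewrite -[X in X ^+ p]ger0_norm ?freq_ge0//.
apply: norm_mul2_le; first by rewrite mulr_ge0// exprn_ge0.
have := H (freq L i.+1); rewrite !char_fun_ev.
set a := ev Y _; set b := ev Y _; set u := ev X _; set v := ev X _.
rewrite lecE/= => /andP[_].
by rewrite -(sqrrN (u - a)) -(sqrrN (v - b)) !opprB.
Qed.

End main_estimate.

(** * The smooth Wasserstein bound *)

Section assembly.
Context {R : realType} {d1 d2 : measure_display} {T1 : measurableType d1} {T2 : measurableType d2}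
  {P : probability T1 R} {Q : probability T2 R} (X : {RV P >-> R}) (Y : {RV Q >-> R}).

Lemma test_function_bounded_measurable {k : nat} {h : R -> R} :
  test_functions k h -> bounded_measurable h.
Proof.
move=> th; apply: (bounded_measurable_continuous 1); first exact: (test_function_continuous 0 th).
by move=> x; exact: (test_function_le1 0 x th).
Qed.

(** Five steps lead from E[h(X)] to E[h(Y)]: truncate, pass to a Fourier sum, change the law,
    and undo the first two steps.  The errors in delta vanish in the limit, although L and N
    depend on delta, because the spectral estimate depends on neither. *)
Lemma ev_test_dist {p : nat} {c eps lambda C alpha : R} {h : R -> R} :
  test_functions p.+1 h -> 0 <= c -> 0 < eps < 1 -> 0 < lambda -> 0 < C -> 0 < alpha ->
  (forall xi : R, `|char_fun Y xi - char_fun X xi| <= ((c * `|xi| ^+ p)%:C)%C) ->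
  (forall A : R, 0 < A ->
    (P [set w | (A < `|X w|)%R] <= (C * expR (- lambda * A `^ alpha))%:E)%E /\
    (Q [set w | (A < `|Y w|)%R] <= (C * expR (- lambda * A `^ alpha))%:E)%E) ->
  `|ev X h - ev Y h| <= 2 * (C * eps) +
    c * Num.sqrt (2 * (tail_radius lambda alpha eps + 1) * jet_bound p p * jet_bound p p.+1).
Proof.
move=> th c0 eps01 l0 C0 a0 Hchar Htail.
have tail eta : 0 < eta < 1 -> let A := tail_radius lambda alpha eta in
    (P [set w | (A < `|X w|)%R] <= (C * eta)%:E)%E /\
    (Q [set w | (A < `|Y w|)%R] <= (C * eta)%:E)%E.
  move=> e01 A; have := Htail A (tail_radius_gt0 _ alpha _ l0 e01).
  by rewrite expR_tail_radius.
pose A := tail_radius lambda alpha eps.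
have A0 : 0 < A by exact: tail_radius_gt0.
pose g := truncated p A h 0.
have hb := test_function_bounded_measurable th.
have gb : bounded_measurable g.
  apply: (bounded_measurable_continuous 1); first exact: (continuous_truncated th 0).
  exact: (truncated_le1 th A0).
pose M := Num.sqrt (2 * (A + 1) * (jet_bound p 0) * (jet_bound p 1)).
have M0 : 0 <= M by exact: sqrtr_ge0.
(* Off the ball of radius B, |g| <= 1 and |S| <= 1 + M, whence the weight 2 + M. *)
apply: (@ler_Dmul_small _ _ _ (2 * (1 + (2 + M) * C))) => [|dl dl01].
  by rewrite mulr_ge0// addr_ge0// mulr_ge0 ?(ltW C0)// addr_ge0.
have [dl0 dl1] := andP dl01.
pose B := tail_radius lambda alpha dl.
have B0 : 0 < B by exact: tail_radius_gt0.
pose L := A + 1 + B + 1.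
have AL : A + 1 < L by rewrite /L; lra.
have BL : B < L by rewrite /L; lra.
have L0 : 0 < L by lra.
have [N HN] := truncated_fourier_sum_uniform th A0 AL dl dl0.
pose S := fourier_sum L g N.
have Sb : bounded_measurable S by exact: bounded_measurable_fourier_sum.
have trunc d (T : measurableType d) (S' : probability T R) (Z : {RV S' >-> R}) :
    (S' [set w | (A < `|Z w|)%R] <= (C * eps)%:E)%E -> `|ev Z h - ev Z g| <= C * eps.
  move=> HZ; suff : `|ev Z h - ev Z g| <= 0 + 1 * (C * eps) by rewrite add0r mul1r.
  apply: (ev_dist Z 0 1 A (C * eps) hb gb) => // [x xA|x].
    by rewrite /g truncated_in// subrr normr0.
  by rewrite add0r; exact: (truncated_dist th A0).
have approx d (T : measurableType d) (S' : probability T R) (Z : {RV S' >-> R}) :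
    (S' [set w | (B < `|Z w|)%R] <= (C * dl)%:E)%E -> `|ev Z g - ev Z S| <= dl + (2 + M) * (C * dl).
  move=> HZ; apply: (ev_dist Z dl (2 + M) B (C * dl) gb Sb) => // [x xB|x|].
  - by apply: HN; rewrite -ltr_norml; exact: le_lt_trans BL.
  - have g1 := truncated_le1 th A0 x; have S1 := truncated_fourier_sum_le th A0 AL N x.
    rewrite (le_trans (ler_normB _ _))//; rewrite -/g -/S -/M in g1 S1; lra.
  - by rewrite addr_ge0.
have [tX tY] := tail eps eps01; have [bX bY] := tail dl dl01.
have h1 := trunc _ _ _ X tX; have h2 := trunc _ _ _ Y tY.
have h3 := approx _ _ _ X bX; have h4 := approx _ _ _ Y bY.
have h5 := ev_fourier_sum_dist X Y L g N p c _ L0 c0 Hchar (truncated_spectrum th A0 AL p N (leqnn p)).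
rewrite -/S in h5.
have -> : ev X h - ev Y h = (ev X h - ev X g) + (ev X g - ev X S) + (ev X S - ev Y S)
   - (ev Y g - ev Y S) - (ev Y h - ev Y g) by ring.
rewrite (le_trans (ler_normB _ _))// (le_trans (lerD (ler_normB _ _) (lexx _)))//.
rewrite (le_trans (lerD (lerD (ler_normD _ _) (lexx _)) (lexx _)))//.
rewrite (le_trans (lerD (lerD (lerD (ler_normD _ _) (lexx _)) (lexx _)) (lexx _)))//.
rewrite -/A; move: h1 h2 h3 h4 h5; set t := c * _; lra.
Qed.

End assembly.

Theorem theorem1 (R : realType) :
  exists Cp : nat -> R,
    [/\ Cp 0%N = 3, Cp 1%N = 12, Cp 2%N = 100 &
    forall (d1 : measure_display) (T1 : measurableType d1)
      (P : probability T1 R) (X : {RV P >-> R})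
      (d2 : measure_display) (T2 : measurableType d2)
      (Q : probability T2 R) (Y : {RV Q >-> R})
      (p : nat) (C' eps lambda C alpha : R),
      0 < C' -> 0 < eps -> eps < 1 ->
      (forall xi : R,
        `|char_fun Y xi - char_fun X xi| <= (C' * eps * `|xi| ^+ p)%:C) ->
      0 < lambda -> 0 < C -> 0 < alpha ->
      (forall A : R, 0 < A ->
        (P [set w | (A < `|X w|)%R] <= (C * expR (- lambda * A `^ alpha))%:E)%E /\
        (Q [set w | (A < `|Y w|)%R] <= (C * expR (- lambda * A `^ alpha))%:E)%E) ->
      (smooth_wasserstein p.+1 X Y <=
        (2 * eps *
          (C + 2 ^ (p%:Z - 1) * Num.sqrt 10 * C' * Cp p / pi *
               Num.sqrt (1 + (lambda^-1 * ln (1 / eps)) `^ (1 / alpha))))%:E)%E].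
Proof.
exists wasserstein_const; split=> //.
move=> d1 T1 P X d2 T2 Q Y p C' eps lambda C alpha C'0 e0 e1 Hchar l0 C0 a0 Htail.
have eps01 : 0 < eps < 1 by rewrite e0.
have c0 : 0 <= C' * eps by rewrite mulr_ge0// ltW.
apply: ub_ereal_sup => _ [h th <-].
have hb := test_function_bounded_measurable th.
rewrite !(evE _ hb) -EFinB/= lee_fin.
apply: (le_trans (ev_test_dist X Y th c0 eps01 l0 C0 a0 Hchar Htail)).
rewrite -/(tail_radius lambda alpha eps).
have A0 := tail_radius_gt0 lambda alpha eps l0 eps01.
have := ler_wpM2l c0 (const_spectrum p _ A0).
have -> : 2 ^ (p%:Z - 1) = 2 ^+ p / 2 :> R by rewrite exprzDr// unitfE.
move=> H; apply: (le_trans (lerD (lexx _) H)).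
rewrite le_eqVlt; apply/orP; left; apply/eqP.
by move: (pi : R) (pi_gt0 R) => pi' /lt0r_neq0 pi0; field.
Qed.
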